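(* If $G$ is a normal cers, then the resonance graph $R(G)$ is isomorphic to the resonance graph of some catacondensed benzenoid graph.
   Context: An even ring system is a simple bipartite 2-connected plane graph in which all interior vertices have degree 3 and all boundary vertices have degree 2 or 3. The inner dual has a vertex for each inner face, two vertices adjacent iff the faces share an edge; two inner faces are adjacent if they share an edge. A cers (catacondensed even ring system) is an even ring system whose inner dual is a tree. A catacondensed benzenoid graph is a cers all of whose inner faces are hexagons. The resonance graph $R(G)$ of a cers $G$ has as vertices the perfect matchings of $G$, with $M_1,M_2$ adjacent iff $M_1\oplus M_2$ is exactly the edge set of one inner face of $G$. For edges $e,f$ of $G$, $d_G(e,f)$ denotes their distance in the line graph of $G$. If $F,F',F''$ are inner faces with $F,F'$ sharing edge $e$ and $F',F''$ sharing edge $f$, the triple $(F,F',F'')$ is regular if $d_G(e,f)$ is even. A cers $G$ is normal if (i) every inner face is adjacent to at most three other inner faces, and (ii) whenever an inner face $F$ is adjacent to three distinct inner faces $F_1,F_2,F_3$, all triples $(F_1,F,F_2)$, $(F_1,F,F_3)$, $(F_2,F,F_3)$ are regular. *)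

(* Defs.v *)
From mathcomp Require Import all_boot fingroup perm.

Set Implicit Arguments.
Unset Strict Implicit.
Unset Printing Implicit Defensive.

Section Relations.
Variables (T : finType) (e : rel T).

Definition connected_on (A : {set T}) : Prop :=
  forall x y, x \in A -> y \in A ->
    connect [rel u v | [&& u \in A, v \in A & e u v]] x y.

Definition acyclic_on (A : {set T}) : Prop :=
  forall c : seq T, {subset c <= A} -> 2 < size c -> ~~ (path.cycle e c && uniq c).

Definition tree_on (A : {set T}) : Prop :=
  [/\ A != set0, connected_on A & acyclic_on A].

(* Number of edges of a shortest path; it is #|T| when there is no path. *)
Definition gdist (x y : T) : nat :=
  find (fun n => [exists p : n.-tuple T, path e x p && (last x p == y)])
       (iota 0 #|T|).

End Relations.

Record sgraph := SGraph {
  vert :> finType;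
  adj : rel vert;
  adj_sym : symmetric adj;
  adj_irr : irreflexive adj
}.
Arguments adj {s} x y.

Section Graphs.
Variable G : sgraph.

Definition degree (v : G) : nat := #|[set w | adj v w]|.

Definition bipartite : Prop :=
  exists col : G -> bool, forall x y : G, adj x y -> col x != col y.

Definition connected : Prop := connected_on (@adj G) [set: G].

Definition two_connected : Prop :=
  [/\ 2 < #|G|, connected & forall v : G, connected_on (@adj G) [set~ v]].

(* The darts are the oriented edges (x, y), with tail x and head y. *)
Definition dart : finType := {p : G * G | adj p.1 p.2}.

Definition dtail (d : dart) : G := (val d).1.
Definition dhead (d : dart) : G := (val d).2.

Lemma rev_subproof (d : dart) : adj (dhead d) (dtail d).
Proof. by rewrite adj_sym; exact: (valP d). Qed.

Definition rev_fun (d : dart) : dart :=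
  exist (fun p : G * G => adj p.1 p.2) (dhead d, dtail d) (rev_subproof d).

Lemma rev_funK : involutive rev_fun.
Proof. by move=> d; apply: val_inj; rewrite /= -surjective_pairing. Qed.

Definition drev : {perm dart} := perm (inv_inj rev_funK).

Definition edge_of (d : dart) : {set G} := [set dtail d; dhead d].
Definition edges : {set {set G}} := [set edge_of d | d : dart].

Definition line_adj : rel {set G} :=
  [rel e f | [&& e \in edges, f \in edges, e != f & e :&: f != set0]].

Definition edge_dist (e f : {set G}) : nat := gdist line_adj e f.

Definition perfect_matching (M : {set {set G}}) : bool :=
  (M \subset edges) && [forall v : G, #|[set e in M | v \in e]| == 1].

End Graphs.

(* A connected plane graph, given up to orientation-preserving homeomorphism
   of the plane by its combinatorial map: rot sends each dart to the next dart
   around its tail, the faces are the orbits of d |-> rot (drev d) (the boundary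
   walks), the embedding surface is the sphere by Euler's formula
   |V| + |F| = |E| + 2, and one of the faces is chosen as the outer face. *)
Record plane_graph := PlaneGraph {
  pgraph :> sgraph;
  pconnected : connected pgraph;
  rot : {perm dart pgraph};
  rotP : forall d, porbit rot d = [set d' | dtail d' == dtail d];
  (* the product of permutations applies its left factor first *)
  face_perm := (drev pgraph * rot)%g;
  euler : #|pgraph| + #|porbits face_perm| = #|edges pgraph| + 2;
  outer : {set dart pgraph};
  outerP : outer \in porbits face_perm
}.

Section PlaneGraphs.
Variable G : plane_graph.
Implicit Types F : {set dart G}.

Definition inner_faces : {set {set dart G}} := porbits (face_perm G) :\ outer G.

Definition boundary_vertex (v : G) : bool := [exists d in outer G, dtail d == v].

Definition face_edges F : {set {set G}} := [set edge_of d | d in F].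

Definition shared_edges F F' : {set {set G}} := face_edges F :&: face_edges F'.

Definition face_adj : rel {set dart G} :=
  [rel F F' | (F != F') && (shared_edges F F' != set0)].

Definition even_ring_system : Prop :=
  [/\ bipartite G,
      two_connected G,
      forall v : G, ~~ boundary_vertex v -> degree v = 3
    & forall v : G, boundary_vertex v -> degree v = 2 \/ degree v = 3].

Definition cers : Prop := even_ring_system /\ tree_on face_adj inner_faces.

Definition catacondensed_benzenoid : Prop :=
  cers /\ forall F, F \in inner_faces -> #|F| = 6.

(* In a cers two adjacent inner faces share exactly one edge. *)
Definition regular F F' F'' : Prop :=
  forall e f, e \in shared_edges F F' -> f \in shared_edges F' F'' ->
    ~~ odd (edge_dist e f).

Definition normal_cers : Prop :=
  [/\ cers,
      forall F, F \in inner_faces ->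
        #|[set F' in inner_faces | face_adj F F']| <= 3
    & forall F F1 F2 F3,
        F \in inner_faces -> F1 \in inner_faces ->
        F2 \in inner_faces -> F3 \in inner_faces ->
        F1 != F2 -> F1 != F3 -> F2 != F3 ->
        face_adj F F1 -> face_adj F F2 -> face_adj F F3 ->
        [/\ regular F1 F F2, regular F1 F F3 & regular F2 F F3]].

Definition resonance_vertex : finType :=
  {M : {set {set G}} | perfect_matching M}.

Definition resonance_adj : rel resonance_vertex :=
  [rel M N | [exists F in inner_faces,
     (val M :\: val N) :|: (val N :\: val M) == face_edges F]].

End PlaneGraphs.

Definition resonance_iso (G H : plane_graph) : Prop :=
  exists f : resonance_vertex G -> resonance_vertex H,
    bijective f /\
    forall M N, resonance_adj (f M) (f N) = resonance_adj M N.

(* Main.v *)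
Require Import Defs.
From mathcomp Require Import all_boot fingroup perm.
From mathcomp Require Import ssralg matrix mxalgebra zify.

(* Fix a proper 2-colouring of the vertices of a cers G and orient every edge
   of the inner dual by the colour of the tail of the dart that one of the two
   faces has on the shared edge.  Perfect matchings of G then correspond to the
   0/1-labellings of the inner faces that are monotone for this orientation,
   flipping a face being a change of a single label: adding the alternating
   matching of the outer cycle to a perfect matching gives a mod 2 cycle, hence
   a sum of face boundaries.  So R(G) depends only on the oriented inner dual.
   Two inner neighbours of F form a regular triple with F iff the two dual edges
   are both outgoing or both incoming at F, so in a normal cers the dual edges
   at a face with three neighbours all go the same way.  Every such oriented
   tree is realised by hexagons, using sides of equal parity for dual edges of
   equal direction.

   Planarity enters through linear algebra over the field with two elements:
   vertex cuts and face boundaries are orthogonal families of edge sets, of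
   ranks at least V - 1 and F - 1.  This gives V + F <= E + 2, and in case of
   equality each family spans the annihilator of the other. *)

Set Implicit Arguments.
Unset Strict Implicit.
Unset Printing Implicit Defensive.

(** * Orthogonal families over the two-element field *)

Section MatrixDuality.
Import GRing.Theory.
Local Open Scope ring_scope.

(** [bool] carries its two-element field structure, with [(+)] as sum and [&&] as product; a family
    of edge sets becomes the matrix of its characteristic rows. *)
Definition fun_mx (A E : finType) (a : A -> E -> bool) : 'M[bool]_(#|A|, #|E|) :=
  \matrix_(i, j) a (enum_val i) (enum_val j).

Definition fun_row (A : finType) (g : A -> bool) : 'rV[bool]_#|A| :=
  \row_i g (enum_val i).

Definition row_fun (A : finType) (u : 'rV[bool]_#|A|) (x : A) : bool :=
  u ord0 (enum_rank x).

Lemma sum_enum_val (A : finType) (F : A -> bool) :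
  \sum_(i < #|A|) F (enum_val i) = \sum_x F x.
Proof.
rewrite (reindex_onto (@enum_rank A) (@enum_val A xpredT)) /=; last first.
  by move=> i _; rewrite enum_valK.
by apply: eq_big => [x|x _]; rewrite enum_rankK ?eqxx.
Qed.

Lemma row_fun_mulmx (A E : finType) (a : A -> E -> bool) u e :
  row_fun (u *m fun_mx a) e = \sum_x row_fun u x * a x e.
Proof.
rewrite /row_fun mxE -[RHS]sum_enum_val; apply: eq_bigr => i _.
by rewrite mxE enum_rankK enum_valK.
Qed.

(** The left kernel lies in the line spanned by the all-ones row. *)
Lemma rank_fun_mx (A E : finType) (a : A -> E -> bool) :
  (forall g : A -> bool, (forall e, \sum_x g x * a x e = 0) ->
     forall x y, g x = g y) ->
  (#|A| <= (\rank (fun_mx a)).+1)%N.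
Proof.
move=> ker_const.
suff: (\rank (kermx (fun_mx a)) <= 1)%N by rewrite mxrank_ker; lia.
apply: leq_trans (rank_leq_row (const_mx 1 : 'rV[bool]_#|A|)).
apply: mxrankS; apply/row_subP => i; set u := row i _.
have u0 : u *m fun_mx a = 0 by rewrite -row_mul mulmx_ker row0.
have {u0} cst : forall x y, row_fun u x = row_fun u y.
  by apply: ker_const => e; rewrite -row_fun_mulmx u0 /row_fun mxE.
have -> : u = u ord0 i *: const_mx 1.
  apply/rowP => j; rewrite [RHS]mxE [X in _ * X]mxE mulr1.
  by have := cst (enum_val j) (enum_val i); rewrite /row_fun !enum_valK.
exact: scalemx_sub.
Qed.

(** The rows of [a] lie in the annihilator of the rows of [b], whose dimension is [#|E|] minus the
    rank of [b]. If the ranks add up to [#|E|], the inclusion is an equality, so every [z]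
    orthogonal to [b] is a combination of rows of [a]. *)
Lemma orthogonal_rank (A B E : finType) (a : A -> E -> bool) (b : B -> E -> bool) :
  (forall x y, \sum_e a x e * b y e = 0) ->
  (\rank (fun_mx a) + \rank (fun_mx b) <= #|E|)%N /\
  ((#|E| <= \rank (fun_mx a) + \rank (fun_mx b))%N ->
   forall z : E -> bool, (forall y, \sum_e z e * b y e = 0) ->
   exists g : A -> bool, forall e, z e = \sum_x g x * a x e).
Proof.
move=> orth.
have ab0 : fun_mx a *m (fun_mx b)^T = 0.
  apply/matrixP => i j; rewrite !mxE -[RHS](orth (enum_val i) (enum_val j)).
  by rewrite -[RHS]sum_enum_val; apply: eq_bigr => k _; rewrite !mxE.
have sub : (fun_mx a <= kermx (fun_mx b)^T)%MS by apply/sub_kermxP.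
have rk : \rank (kermx (fun_mx b)^T) = (#|E| - \rank (fun_mx b))%N.
  by rewrite mxrank_ker mxrank_tr.
have le_b : (\rank (fun_mx b) <= #|E|)%N by rewrite rank_leq_col.
have := mxrankS sub; rewrite rk => le_a; split; first by lia.
move=> geE z z0.
have : (fun_row z <= fun_mx a)%MS.
  apply: submx_trans (_ : kermx (fun_mx b)^T <= _)%MS.
    apply/sub_kermxP/rowP => j; rewrite !mxE -[RHS](z0 (enum_val j)).
    by rewrite -[RHS]sum_enum_val; apply: eq_bigr => k _; rewrite !mxE.
  rewrite -(mxrank_leqif_sup sub) rk; apply/eqP; lia.
case/submxP => u zu; exists (row_fun u) => e.
by rewrite -row_fun_mulmx -zu /row_fun mxE enum_rankK.
Qed.

Lemma sum_bool_odd (T : finType) (P : pred T) (F : T -> bool) :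
  \sum_(i | P i) F i = odd #|[set i | P i && F i]|.
Proof.
rewrite -sum1dep_card (big_morph odd oddD (erefl : odd 0 = false)).
rewrite [RHS]big_mkcondr /=.
by apply: eq_bigr => i _; case: (F i).
Qed.

End MatrixDuality.

(** * Cycles and cuts of combinatorial maps *)

Lemma porbit_ind (T : finType) (s : {perm T}) (S : T -> Prop) x y :
  (forall z, S z -> S (s z)) -> S x -> y \in porbit s x -> S y.
Proof.
move=> clS Sx /porbitP[i ->]; rewrite permX.
by elim: i => //= i IHi; apply: clS.
Qed.

Lemma connect_ind (T : finType) (e : rel T) (S : T -> Prop) x y :
  (forall u v, e u v -> S u -> S v) -> connect e x y -> S x -> S y.
Proof.
move=> clS /connectP[p ep ->]; elim: p x ep => //= z p IHp x /andP[exz ep] Sx.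
exact: IHp ep (clS _ _ exz Sx).
Qed.

Section Darts.
Variable G : sgraph.
Implicit Types d : dart G.

Lemma dtail_drev d : dtail (drev G d) = dhead d.
Proof. by rewrite /drev permE. Qed.

Lemma dhead_drev d : dhead (drev G d) = dtail d.
Proof. by rewrite /drev permE. Qed.

Lemma drevK d : drev G (drev G d) = d.
Proof. by rewrite /drev !permE rev_funK. Qed.

Lemma edge_of_drev d : edge_of (drev G d) = edge_of d.
Proof. by rewrite /edge_of dtail_drev dhead_drev setUC. Qed.

Lemma dart_inj d d' : dtail d = dtail d' -> dhead d = dhead d' -> d = d'.
Proof.
move=> t h; apply: val_inj.
by rewrite [val d]surjective_pairing [val d']surjective_pairing -/(dtail d)
           -/(dhead d) t h.
Qed.

Lemma adj_dart d : adj (dtail d) (dhead d).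
Proof. exact: (valP d). Qed.

Lemma dtail_neq_dhead d : dtail d != dhead d.
Proof. by apply/eqP => e; have := adj_dart d; rewrite e adj_irr. Qed.

Lemma dart_of_adj (x y : G) : adj x y -> exists2 d, dtail d = x & dhead d = y.
Proof. by move=> a; exists (exist (fun p : G * G => adj p.1 p.2) (x, y) a). Qed.

Lemma drev_neq d : drev G d != d.
Proof.
by apply/eqP => e; have := dtail_neq_dhead d; rewrite -dtail_drev e eqxx.
Qed.

Lemma dtail_edge d : dtail d \in edge_of d.
Proof. by rewrite !inE eqxx. Qed.

Lemma dhead_edge d : dhead d \in edge_of d.
Proof. by rewrite !inE eqxx orbT. Qed.

Lemma edge_of_edges d : edge_of d \in edges G.
Proof. exact: imset_f. Qed.

Lemma dart_of_mem_edge d v : v \in edge_of d ->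
  exists2 d', edge_of d' = edge_of d & dtail d' = v.
Proof.
rewrite !inE => /orP[] /eqP->; first by exists d.
by exists (drev G d); rewrite ?edge_of_drev ?dtail_drev.
Qed.

Lemma edge_of_inj_tail d d' :
  edge_of d = edge_of d' -> dtail d = dtail d' -> d = d'.
Proof.
move=> e t; apply: (dart_inj t); have := dhead_edge d.
rewrite e !inE -t eq_sym (negbTE (dtail_neq_dhead d)) /=.
by move/eqP.
Qed.

Lemma edge_of_eq d d' : (edge_of d == edge_of d') = (d \in [set d'; drev G d']).
Proof.
rewrite !inE; apply/eqP/orP => [e|[] /eqP-> //]; last exact: edge_of_drev.
have := dtail_edge d; rewrite e !inE => /orP[] /eqP t; [left|right]; apply/eqP.
  exact: edge_of_inj_tail.
by apply: edge_of_inj_tail; rewrite ?edge_of_drev ?dtail_drev.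
Qed.

Lemma mem_two_edge d (u v : G) : u != v -> u \in edge_of d -> v \in edge_of d ->
  edge_of d = [set u; v].
Proof.
move=> uv; rewrite !inE /edge_of.
case/orP=> /eqP eu /orP[] /eqP ev; rewrite ?eu ?ev //.
- by rewrite eu ev eqxx in uv.
- by rewrite setUC.
- by rewrite eu ev eqxx in uv.
Qed.

Lemma card_dart : #|dart G| = (#|edges G|).*2.
Proof.
rewrite -cardsT -sum1_card (partition_big (@edge_of G) (mem (edges G))) /=; last first.
  by move=> d _; exact: edge_of_edges.
rewrite -muln2 -sum_nat_const; apply: eq_bigr => _ /imsetP[d _ ->].
rewrite sum1dep_card (_ : [set _ | _] = [set d; drev G d]); last first.
  by apply/setP => d'; rewrite inE edge_of_eq !inE.
by rewrite cards2 eq_sym drev_neq.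
Qed.

Lemma degreeE v : degree v = #|[set d : dart G | dtail d == v]|.
Proof.
rewrite /degree -(card_in_imset (f := @dhead G) (D := [set d | dtail d == v])).
  apply: eq_card => w; rewrite inE; apply/idP/imsetP => [|[d]].
    by case/dart_of_adj => d t h; exists d; rewrite ?inE ?t.
  by rewrite inE => /eqP <- ->; exact: adj_dart.
move=> d d'; rewrite !inE => /eqP t /eqP t' h.
by apply: dart_inj h; rewrite t t'.
Qed.

Lemma card_matching_at (M : {set {set G}}) v : M \subset edges G ->
  #|[set e in M | v \in e]| = #|[set d | (dtail d == v) && (edge_of d \in M)]|.
Proof.
move=> /subsetP sM.
rewrite -(card_in_imset (f := @edge_of G)
            (D := [set d | (dtail d == v) && (edge_of d \in M)])).
  apply: eq_card => e; rewrite inE; apply/andP/imsetP => [[eM]|[d]].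
    have /imsetP[d _ ed] := sM _ eM; rewrite ed => /dart_of_mem_edge[d' e' t].
    by exists d'; rewrite ?e' // inE t eqxx e' -ed.
  by rewrite inE => /andP[/eqP <- dM] ->; rewrite dM dtail_edge.
move=> d d'; rewrite !inE => /andP[/eqP t _] /andP[/eqP t' _] e.
by apply: edge_of_inj_tail; rewrite // t t'.
Qed.

End Darts.

(** * Face boundaries, vertex stars and Euler's inequality *)

Section Maps.
Import GRing.Theory.
Local Open Scope ring_scope.

Variables (G : sgraph) (rt : {perm dart G}).
Hypothesis conn : connected G.
Hypothesis rtP : forall d, porbit rt d = [set d' | dtail d' == dtail d].
Let fp := (drev G * rt)%g.
Let fc d := porbit fp d.
Let E : finType := {e : {set G} | e \in edges G}.
Let Fc : finType := {F : {set dart G} | F \in porbits fp}.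
Implicit Types d : dart G.

Let edgeT d : E := exist _ (edge_of d) (edge_of_edges d).

Let face_in d : fc d \in porbits fp.
Proof. exact: imset_f. Qed.

Let faceT d : Fc := exist _ (fc d) (face_in d).

Lemma face_permE d : fp d = rt (drev G d).
Proof. by rewrite permM. Qed.

Lemma dtail_rot d : dtail (rt d) = dtail d.
Proof. by have /eqP := mem_porbit rt 1 d; rewrite expg1 rtP inE => /eqP/eqP. Qed.

Lemma dtail_face_perm d : dtail (fp d) = dhead d.
Proof. by rewrite face_permE dtail_rot dtail_drev. Qed.

Lemma face_face_perm d : fc (fp d) = fc d.
Proof. by have := porbit_perm fp 1 d; rewrite expg1. Qed.

Lemma face_rot d : fc (rt d) = fc (drev G d).
Proof. by rewrite -[in LHS](drevK d) -face_permE face_face_perm. Qed.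

Lemma sum_edge_darts d (f : dart G -> bool) :
  \sum_(d' | edge_of d' == edge_of d) f d' = f d + f (drev G d).
Proof.
rewrite (eq_bigl (mem [set d; drev G d])); last by move=> d'; exact: edge_of_eq.
by rewrite big_setU1 ?big_set1 // inE eq_sym drev_neq.
Qed.

Lemma sum_edges_pred1 d (x : {set G} -> bool) :
  \sum_(e : E) x (val e) * (edge_of d == val e) = x (edge_of d).
Proof.
rewrite (bigD1 (edgeT d)) //= eqxx mulr1 big1 ?addr0 // => e ne.
case: eqP => [ed|_]; last by rewrite mulr0.
by case/eqP: ne; apply: val_inj.
Qed.

Lemma edgeP (e : E) : exists d, val e = edge_of d.
Proof. by case: e => e /= /imsetP[d _ ->]; exists d. Qed.

Lemma sum_vertices_edge d (g : G -> bool) :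
  \sum_v g v * (v \in edge_of d) = g (dtail d) + g (dhead d).
Proof.
transitivity (\sum_(v in edge_of d) g v).
  by rewrite [RHS]big_mkcond; apply: eq_bigr => v _; case: ifP; rewrite ?mulr1 ?mulr0.
by rewrite big_setU1 ?big_set1 // inE dtail_neq_dhead.
Qed.

(** The sum is taken in the two-element field: an edge that the walk of [F] traverses twice
    cancels. *)
Let bd (F : {set dart G}) (e : {set G}) : bool :=
  \sum_(d in F) (edge_of d == e).

Lemma sum_boundary (F : {set dart G}) (x : {set G} -> bool) :
  \sum_(e : E) x (val e) * bd F (val e) = \sum_(d in F) x (edge_of d).
Proof.
under eq_bigr do rewrite mulr_sumr.
by rewrite exchange_big; apply: eq_bigr => d _; rewrite sum_edges_pred1.
Qed.

Lemma sum_faces_boundary d (g : Fc -> bool) (F F' : Fc) :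
  val F = fc d -> val F' = fc (drev G d) ->
  \sum_K g K * bd (val K) (edge_of d) = g F + g F'.
Proof.
have sumF d' K : val K = fc d' -> \sum_(L : Fc) g L * (d' \in val L) = g K.
  move=> eK; rewrite (bigD1 K) //= eK porbit_id mulr1 big1 ?addr0 // => L ne.
  case: (boolP (d' \in _)) => [dL|_]; last by rewrite mulr0.
  case/eqP: ne; apply: val_inj; rewrite eK.
  case: L dL => L /= /imsetP[d0 _ ->] dL.
  by apply/eqP; rewrite eq_sym eq_porbit_mem.
move=> eF eF'; rewrite -(sumF _ _ eF) -(sumF _ _ eF').
rewrite -(sum_edge_darts d (fun d' => \sum_(L : Fc) g L * (d' \in val L))).
rewrite exchange_big; apply: eq_bigr => K _; rewrite -mulr_sumr; congr (_ * _).
rewrite /bd big_mkcond [RHS]big_mkcond; apply: eq_bigr => d' _.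
by case: (d' \in _) (_ == _) => [] [].
Qed.

Lemma sum_edges_at v (x : {set G} -> bool) :
  \sum_(e : E) x (val e) * (v \in val e) = \sum_(d | dtail d == v) x (edge_of d).
Proof.
under [RHS]eq_bigr do rewrite -sum_edges_pred1.
rewrite exchange_big; apply: eq_bigr => e _; rewrite -mulr_sumr; congr (_ * _).
have [d ->] := edgeP e; transitivity ((dtail d == v) + (dhead d == v)).
  rewrite !inE ![v == _]eq_sym; have := dtail_neq_dhead d.
  by case: (dtail d =P v) => [->|_]; case: (dhead d =P v) => [->|_] //; rewrite ?eqxx.
rewrite -dtail_drev -(sum_edge_darts d (fun d => dtail d == v)).
rewrite big_mkcond [RHS]big_mkcond; apply: eq_bigr => d' _.
by case: (_ == v); case: (_ == edge_of d).
Qed.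

(** A face walk leaves [v] as often as it enters it: the edge of [d] joins the tails of [d] and
    [fp d], and [fp] permutes the darts of [F], so the two sums over tails agree. *)
Lemma boundary_orthogonal v (F : Fc) :
  \sum_(e : E) (v \in val e) * bd (val F) (val e) = 0.
Proof.
rewrite (sum_boundary (val F) (fun e => v \in e)).
transitivity (\sum_(d in val F) ((dtail d == v) + (dtail (fp d) == v))).
  apply: eq_bigr => d _; rewrite dtail_face_perm !inE ![v == _]eq_sym.
  have := dtail_neq_dhead d.
  by case: (dtail d =P v) => [->|_]; case: (dhead d =P v) => [->|_] //; rewrite ?eqxx.
rewrite big_split /= [X in X + _](reindex_inj (@perm_inj _ fp)) /=.
rewrite (eq_bigl (mem (val F))) => [|d]; first exact: addbb.
case: F => F /= /imsetP[d0 _ ->].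
by rewrite -!eq_porbit_mem -/(fc d) -face_face_perm.
Qed.

Lemma vertex_kernel (g : G -> bool) :
  (forall d, g (dtail d) = g (dhead d)) -> forall u v, g u = g v.
Proof.
move=> gd u v; have := conn (in_setT u) (in_setT v).
move/(connect_ind (S := fun w => g u = g w)); apply=> // x y /= /and3P[_ _].
by case/dart_of_adj => d <- <- ->.
Qed.

(** The dual graph is connected: turning around a vertex crosses one edge at a time, and walks in
    [G] lead from one vertex to any other. *)
Lemma face_kernel (g : {set dart G} -> bool) :
  (forall d, g (fc d) = g (fc (drev G d))) -> forall d d', g (fc d) = g (fc d').
Proof.
move=> gd.
have gt d d' : dtail d' = dtail d -> g (fc d') = g (fc d).
  move=> t; have : d' \in porbit rt d by rewrite rtP inE t.
  apply: (porbit_ind (S := fun x => g (fc x) = g (fc d))) => // z <-.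
  by rewrite face_rot -gd.
move=> d d'; have := conn (in_setT (dtail d)) (in_setT (dtail d')).
move/(connect_ind (S := fun w => forall x, dtail x = w -> g (fc d) = g (fc x))).
apply=> // [u v /= /and3P[_ _]|x /gt->//].
case/dart_of_adj => y <- <- /(_ _ erefl) -> x t.
by rewrite gd; apply/esym/gt; rewrite dtail_drev.
Qed.

Let va (v : G) (e : E) : bool := v \in val e.
Let ba (F : Fc) (e : E) : bool := bd (val F) (val e).

Lemma card_edge_type : #|E| = #|edges G|.
Proof. by rewrite card_sig; apply: eq_card => e; rewrite inE. Qed.

Lemma card_face_type : #|Fc| = #|porbits fp|.
Proof. by rewrite card_sig; apply: eq_card => e; rewrite inE. Qed.

Lemma rank_vertices : (#|G| <= (\rank (fun_mx va)).+1)%N.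
Proof.
apply: rank_fun_mx => g g0; apply: vertex_kernel => d.
have := g0 (edgeT d); rewrite /va /= sum_vertices_edge.
by case: (g _) (g _) => [] [].
Qed.

Lemma rank_faces : (#|porbits fp| <= (\rank (fun_mx ba)).+1)%N.
Proof.
rewrite -card_face_type; apply: rank_fun_mx => g g0.
(* [face_kernel] expects a function on all sets of darts, so [g] is extended by [false]. *)
pose g' F := if insub F is Some K then g K else false.
have g'E K : g K = g' (val K) by rewrite /g' valK.
suff gc d d' : g' (fc d) = g' (fc d').
  by case=> x xP [y yP]; rewrite !g'E /=; case/imsetP: xP => ? _ ->;
     case/imsetP: yP => ? _ ->; apply: gc.
move: d d'; apply: face_kernel => d.
have := g0 (edgeT d); rewrite /ba /=.
rewrite (@sum_faces_boundary d g (faceT d) (faceT (drev G d))) //.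
by rewrite !g'E /=; case: (g' _) (g' _) => [] [].
Qed.

(** The two ranks are at least V - 1 and F - 1 and add up to at most E. The rotation [rt] is
    arbitrary, so that the bound can be applied to the hexagon system before its Euler formula is
    known. *)
Lemma euler_ineq : (#|G| + #|porbits fp| <= #|edges G| + 2)%N.
Proof.
have [le_E _] := @orthogonal_rank _ _ _ va ba boundary_orthogonal.
by have := rank_vertices; have := rank_faces; rewrite -card_edge_type; lia.
Qed.

Hypothesis euler_eq : (#|G| + #|porbits fp| = #|edges G| + 2)%N.

(** An edge set of even degree everywhere is orthogonal to the vertex stars, hence by Euler's
    formula a sum of face boundaries. The function [f] selects the faces; an edge survives iff
    exactly one of its sides is selected. *)
Lemma boundary_of_cycle (x : {set G} -> bool) :
  (forall v, \sum_(d | dtail d == v) x (edge_of d) = 0) ->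
  exists f : {set dart G} -> bool,
    forall d, x (edge_of d) = f (fc d) (+) f (fc (drev G d)).
Proof.
move=> cyc.
have orth F v : \sum_(e : E) ba F e * va v e = 0.
  by rewrite -[RHS](boundary_orthogonal v F); apply: eq_bigr => e _; rewrite mulrC.
have [_ dual] := @orthogonal_rank _ _ _ ba va orth.
have [||g gE] := dual _ (fun e => x (val e)).
- by have := rank_vertices; have := rank_faces; have := euler_eq; have := card_edge_type; lia.
- by move=> v; rewrite sum_edges_at.
exists (fun F => if insub F is Some K then g K else false) => d.
have := gE (edgeT d); rewrite /= => ->.
rewrite (@sum_faces_boundary d g (faceT d) (faceT (drev G d))) //.
by rewrite -[fc d]/(val (faceT d)) -[fc (drev G d)]/(val (faceT (drev G d))) !valK.
Qed.

(** Dually, an edge set that meets every face walk evenly is a sum of vertex stars, that is, a cut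
    whose sides are given by [g]. *)
Lemma cut_of_dual_cycle (x : {set G} -> bool) :
  (forall d0, \sum_(d in fc d0) x (edge_of d) = 0) ->
  exists g : G -> bool, forall d, x (edge_of d) = g (dtail d) (+) g (dhead d).
Proof.
move=> cyc.
have [_ dual] := @orthogonal_rank _ _ _ va ba boundary_orthogonal.
have [||g gE] := dual _ (fun e => x (val e)).
- by have := rank_vertices; have := rank_faces; have := euler_eq; have := card_edge_type; lia.
- by move=> F; rewrite /ba sum_boundary; case: F => F /= /imsetP[d _ ->].
exists g => d.
by have := gE (edgeT d); rewrite /= sum_vertices_edge.
Qed.

End Maps.

(** * Faces and vertices of a cers *)

Definition face (G : plane_graph) (d : dart G) : {set dart G} :=
  porbit (face_perm G) d.

Section PlaneGraphFaces.
Variable G : plane_graph.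
Implicit Types d : dart G.
Local Notation rt := (@Defs.rot G).

Lemma mem_face d d' : (d \in face d') = (face d == face d').
Proof. by rewrite eq_porbit_mem. Qed.

Lemma face_porbits d : face d \in porbits (face_perm G).
Proof. exact: imset_f. Qed.

Lemma mem_outer d : (d \in outer G) = (face d == outer G).
Proof. by have /imsetP[d' _ ->] := outerP G; apply: mem_face. Qed.

Lemma face_inner d : (face d \in inner_faces G) = (face d != outer G).
Proof. by rewrite !inE face_porbits andbT. Qed.

Lemma inner_face_dart F : F \in inner_faces G ->
  exists2 d, F = face d & face d != outer G.
Proof. by rewrite !inE => /andP[ne /imsetP[d _ e]]; exists d; rewrite // /face -e. Qed.

Lemma face_of_rot d : face (rt d) = face (drev G d).
Proof. exact: face_rot. Qed.

Lemma dtail_of_rot d : dtail (rt d) = dtail d.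
Proof. exact/dtail_rot/rotP. Qed.

Lemma face_of_face_perm d : face (face_perm G d) = face d.
Proof. exact: face_face_perm. Qed.

Lemma dtail_of_face_perm d : dtail (face_perm G d) = dhead d.
Proof. exact/dtail_face_perm/rotP. Qed.

Lemma rot_drev d : rt (drev G d) = face_perm G d.
Proof. by rewrite permM. Qed.

Lemma sum_face_edge d0 d :
  (\sum_(d' in face d0) ((edge_of d' == edge_of d) : bool))%R
  = (face d == face d0) (+) (face (drev G d) == face d0).
Proof.
rewrite -!mem_face.
apply: etrans (sum_edge_darts d (fun d' => d' \in face d0)).
rewrite big_mkcond [RHS]big_mkcond; apply: eq_bigr => d' _.
by case: (d' \in _); case: (_ == edge_of d).
Qed.

(* A closed curve of the sphere crossing the edges of [d1] and [d2] only. *)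
Lemma two_edge_cut d1 d2 :
  face d1 = face d2 -> face (drev G d1) = face (drev G d2) ->
  exists g : G -> bool, forall d, g (dtail d) (+) g (dhead d) =
    (edge_of d == edge_of d1) (+) (edge_of d == edge_of d2).
Proof.
move=> e e'.
have [|g gE] := cut_of_dual_cycle (@pconnected G) (@rotP G) (euler G)
  (x := fun f => (f == edge_of d1) (+) (f == edge_of d2)); last by exists g.
by move=> d0; rewrite big_split /= !sum_face_edge e e'; exact: addbb.
Qed.

(** The face on both sides of the edge traverses it twice, so the single edge meets every face walk
    evenly: it is a bridge. *)
Lemma one_edge_cut d1 : face d1 = face (drev G d1) ->
  exists g : G -> bool, forall d,
    g (dtail d) (+) g (dhead d) = (edge_of d == edge_of d1).
Proof.
move=> e.
have [|g gE] := cut_of_dual_cycle (@pconnected G) (@rotP G) (euler G)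
  (x := fun f => f == edge_of d1); last by exists g.
by move=> d0; rewrite sum_face_edge -e addbb.
Qed.

Lemma face_edgesP e d0 :
  reflect (exists2 d, e = edge_of d & face d = face d0) (e \in face_edges (face d0)).
Proof.
apply: (iffP imsetP) => [[d]|[d -> ef]]; last by exists d; rewrite // mem_face ef.
by rewrite mem_face => /eqP; exists d.
Qed.

Lemma edge_of_face_edges d d0 :
  (edge_of d \in face_edges (face d0)) =
  (face d == face d0) || (face (drev G d) == face d0).
Proof.
apply/face_edgesP/orP => [[d' /eqP]|[] /eqP]; last 2 first.
- by exists d.
- by exists (drev G d); rewrite ?edge_of_drev.
by rewrite edge_of_eq !inE => /orP[] /eqP-> <-; rewrite ?drevK; [left|right].
Qed.

Lemma face_adj_drev d : face d != face (drev G d) ->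
  face_adj (face d) (face (drev G d)).
Proof.
move=> ne; rewrite /face_adj /= ne; apply/set0Pn; exists (edge_of d).
by rewrite inE !edge_of_face_edges ?eqxx ?orbT.
Qed.

Lemma face_adjP d1 d2 : face_adj (face d1) (face d2) ->
  exists2 d, face d = face d1 & face (drev G d) = face d2.
Proof.
case/andP=> ne /set0Pn[e]; rewrite inE => /andP[/face_edgesP[d -> ed]].
rewrite edge_of_face_edges ed (negbTE ne) /= => /eqP ed'.
by exists d.
Qed.

End PlaneGraphFaces.

(** * Local structure of a cers along its outer walk *)

Section CersStructure.
Variable G : plane_graph.
Hypothesis hG : cers G.
Implicit Types d o : dart G.
Local Notation rt := (@Defs.rot G).
Local Notation out := (outer G).

(** Otherwise the edge is a bridge with sides [g]. Deleting one endpoint leaves a connected graph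
    without that edge, on which [g] is constant; a third vertex [z] then has the same side as either
    endpoint. *)
Lemma face_neq_drev d : face d != face (drev G d).
Proof.
apply/negP => /eqP /one_edge_cut[g gE].
have [[_ [cardG _ conn2] _ _] _] := hG.
have away u x y : u \in edge_of d -> x != u -> y != u -> g x = g y.
  move=> ud xu yu; have := conn2 u x y; rewrite !inE xu yu => /(_ isT isT).
  move/(connect_ind (S := fun z => g x = g z)); apply=> // a b /= /and3P[].
  rewrite !inE => au bu /dart_of_adj[d' ta hb] ->.
  have := gE d'; rewrite ta hb; case: eqP => [e|_].
    by move: ud; rewrite -e !inE ta hb !(eq_sym u) (negbTE au) (negbTE bu).
  by case: (g a) (g b) => [] [].
have [z zd] : exists z, z \notin edge_of d.
  apply/existsP; rewrite -negb_forall; apply/negP => /forallP all_d.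
  have := subset_leq_card (introT subsetP (fun x _ => all_d x) : [set: G] \subset edge_of d).
  by rewrite cardsT cards2 => /(leq_trans cardG); case: (_ != _).
rewrite !inE negb_or in zd; have /andP[zt zh] := zd.
have := gE d; rewrite eqxx.
rewrite (away (dhead d) (dtail d) z) ?dhead_edge ?dtail_neq_dhead //.
rewrite (away (dtail d) (dhead d) z) ?dtail_edge ?addbb //.
by rewrite eq_sym dtail_neq_dhead.
Qed.

Lemma degree23 (v : G) : degree v = 2 \/ degree v = 3.
Proof.
have [[_ _ h3 h23] _] := hG.
by case: (boolP (boundary_vertex v)) => [/h23|/h3]; [|right].
Qed.

Lemma darts_at d (f : dart G -> nat) :
  rt (rt d) = d /\
    \sum_(x | dtail x == dtail d) f x = f d + f (rt d)
  \/ [/\ rt (rt (rt d)) = d, rt (rt d) != d &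
    \sum_(x | dtail x == dtail d) f x = f d + (f (rt d) + f (rt (rt d)))].
Proof.
have card_orb : #|porbit rt d| = degree (dtail d) by rewrite rotP degreeE.
have sumE : \sum_(x | dtail x == dtail d) f x
          = \sum_(x <- traject rt d #|porbit rt d|) f x.
  rewrite [RHS](big_uniq _ (uniq_traject_porbit _ _)); apply: eq_bigl => x.
  by rewrite -porbit_traject rotP inE.
have := iter_porbit rt d; have := uniq_traject_porbit rt d.
rewrite sumE card_orb.
case: (degree23 (dtail d)) => -> /=; rewrite !inE andbT.
  by move=> _ e; left; split; rewrite // !big_cons big_nil addn0.
case/andP=> /norP[_ ne] _ e; right; split=> //; first by rewrite eq_sym.
by rewrite !big_cons big_nil addn0.
Qed.

Lemma rot_cases d d' : dtail d' = dtail d ->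
  [\/ d' = d, d' = rt d | d' = rt (rt d) /\ rt (rt (rt d)) = d].
Proof.
move=> t.
have : 0 < \sum_(x | dtail x == dtail d) (x == d').
  by rewrite (bigD1 d') ?t //= eqxx.
case: (darts_at d (fun x => nat_of_bool (x == d'))) => [[_ ->]|[e _ ->]].
  by rewrite addn_gt0 !lt0b => /orP[] /eqP <-; [apply: Or31|apply: Or32].
rewrite !addn_gt0 !lt0b => /or3P[] /eqP e'.
- by apply: Or31.
- by apply: Or32.
- by apply: Or33; rewrite -e'.
Qed.

(** With at most three darts at a vertex, any two of them are cyclically consecutive, and
    consecutive darts lie on the two sides of one edge. *)
Lemma face_inj_at d d' : dtail d' = dtail d -> face d' = face d -> d' = d.
Proof.
case/rot_cases => [//|->|[-> e]] ef.
- by have := face_neq_drev d; rewrite -face_of_rot ef eqxx.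
- by have := face_neq_drev (rt (rt d)); rewrite -face_of_rot e ef eqxx.
Qed.

(** An interior vertex has degree 3, so the three faces around it would form a triangle in the inner
    dual, which is a tree. *)
Lemma outer_at (v : G) : exists2 o, dtail o = v & face o = out.
Proof.
case: (boolP (boundary_vertex v)) => [/exists_inP[d]|nb].
  by rewrite mem_outer => /eqP fd /eqP t; exists d.
have [[_ _ h3 _] [_ _ acyc]] := hG.
have inner d : dtail d = v -> face d != out.
  move=> t; apply: contra nb => fd; apply/exists_inP; exists d; rewrite ?t //.
  by rewrite mem_outer.
have /card_gt0P[d] : 0 < #|[set d : dart G | dtail d == v]|.
  by rewrite -degreeE h3.
rewrite inE => /eqP t.
have := darts_at d (fun=> 1); rewrite t sum1dep_card -degreeE h3 //.
case=> [[]//|[e ne _]].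
have ad x : face_adj (face x) (face (rt x)).
  by rewrite face_of_rot; apply: face_adj_drev; apply: face_neq_drev.
have nx x : face x != face (rt x) by rewrite face_of_rot face_neq_drev.
have := acyc [:: face d; face (rt d); face (rt (rt d))] _ isT.
move=> /(_ _) /negP[] => [F|].
  rewrite !inE.
  by case/or3P=> /eqP->; rewrite face_porbits andbT inner ?dtail_of_rot.
apply/andP; split.
  have ad3 := ad (rt (rt d)); rewrite e in ad3.
  by apply/and4P; split; try done; apply: ad.
have ne3 : face d != face (rt (rt d)).
  by have := nx (rt (rt d)); rewrite e eq_sym.
by rewrite /= !inE negb_or !nx ne3.
Qed.

(** The local picture: in rotation order from [o] come the outer face and then one inner face
    (degree 2) or two (degree 3). In the second case the edge of [rt o] separates the two inner
    faces and the other two edges are on the boundary. *)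
Lemma vertex_sum o (f : dart G -> nat) : face o = out ->
  face (rt o) != out /\
  (face (drev G (rt o)) = out /\
     \sum_(x | dtail x == dtail o) f x = f o + f (rt o)
  \/ [/\ face (rt (rt o)) != out, face (drev G (rt (rt o))) = out &
     \sum_(x | dtail x == dtail o) f x = f o + (f (rt o) + f (rt (rt o)))]).
Proof.
move=> fo; split; first by rewrite face_of_rot -fo eq_sym face_neq_drev.
case: (darts_at o f) => [[e ->]|[e _ ->]]; [left|right]; split=> //.
- by rewrite -face_of_rot e.
- by rewrite -fo -{2}e [face (rt (rt (rt o)))]face_of_rot face_neq_drev.
- by rewrite -face_of_rot e.
Qed.

(** A dart between two inner faces is the middle one of the three at its tail, so the next dart
    [rt d] is a boundary dart of the face across [d]. *)
Lemma inner_dart_rot d : face d != out -> face (drev G d) != out ->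
  exists o, [/\ face o = out, d = rt o, face (rt d) = face (drev G d)
    & face (drev G (rt d)) = out].
Proof.
move=> fd fd'; have [o t fo] := outer_at (dtail d).
case: (rot_cases (esym t)) => [e|e|[e e3]].
- by rewrite e fo eqxx in fd.
- exists o; split; rewrite ?face_of_rot //.
  case: (@vertex_sum o (fun=> 0) fo) => _ [[]|[]]; rewrite -?e => // e'.
  by rewrite e' eqxx in fd'.
- by rewrite e -face_of_rot e3 fo eqxx in fd'.
Qed.

(** At the tail of [d0], either [d0] itself or a dart of the same face ending there borders the
    outer face. *)
Lemma boundary_dart d0 : face d0 != out ->
  exists2 d, face d = face d0 & face (drev G d) = out.
Proof.
move=> f0; have [o t fo] := outer_at (dtail d0).
case: (rot_cases (esym t)) => [e|e|[e e3]].
- by rewrite e fo eqxx in f0.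
- by exists (drev G o); rewrite ?drevK // -face_of_rot e.
- by exists d0; rewrite // e -face_of_rot e3.
Qed.

(* The outer walk visits every vertex and avoids the edges of the inner dual,
   so no closed curve crossing only such edges separates two vertices. *)
Lemma shared_dart_uniq d d' : face d != out -> face (drev G d) != out ->
  face d = face d' -> face (drev G d) = face (drev G d') -> d = d'.
Proof.
move=> fd fd' e e'; have [g gE] := two_edge_cut e e'.
have gc x y : g x = g y.
  have [o <- fo] := outer_at x; have [o' <- fo'] := outer_at y.
  have : o' \in face o by rewrite mem_face fo fo'.
  pose S z := face z = out /\ g (dtail o) = g (dtail z).
  move=> o'o; suff [] : S o' by [].
  apply: porbit_ind o'o => // z [fz gz]; split; first by rewrite face_of_face_perm.
  have nz x' : face x' != out -> face (drev G x') != out -> edge_of z != edge_of x'.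
    move=> n1 n2; rewrite edge_of_eq !inE; apply/norP; split.
      by apply: contraNneq n1 => <-; rewrite fz.
    by apply: contraNneq n2 => <-; rewrite fz.
  rewrite dtail_of_face_perm gz; have := gE z.
  by rewrite !(negbTE (nz _ _ _)) -?e -?e' //; case: (g _) (g _) => [] [].
have := gE d; rewrite (gc (dtail d) (dhead d)) addbb eqxx addTb => /esym/negbFE.
rewrite edge_of_eq !inE => /orP[] /eqP // ed.
by have := face_neq_drev d; rewrite {1}ed -e' eqxx.
Qed.

End CersStructure.

(** * Perfect matchings as monotone labellings *)

Definition proper_colouring (G : sgraph) (col : G -> bool) : Prop :=
  forall x y : G, adj x y -> col x != col y.

Section Resonance.
Variable G : plane_graph.
Hypothesis hG : cers G.
Variable col : G -> bool.
Hypothesis colP : proper_colouring col.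
Variables (I : finType) (io : I -> {set dart G}).
Hypothesis io_inj : injective io.
Hypothesis io_img : inner_faces G = [set io i | i : I].
Implicit Types (d o : dart G) (h : {ffun I -> bool}).
Local Notation rt := (@Defs.rot G).
Local Notation out := (outer G).

Definition dual_rel : rel I :=
  [rel i j | [exists d : dart G,
     [&& col (dtail d), face d == io i & face (drev G d) == io j]]].

Definition monotone (R : rel I) h : Prop := forall i j, R i j -> h j -> h i.

Lemma col_dhead d : col (dhead d) = ~~ col (dtail d).
Proof. by have := colP (adj_dart d); case: (col _) (col _) => [] []. Qed.

Definition up h (F : {set dart G}) : bool := [exists i, (io i == F) && h i].

Lemma up_io h i : up h (io i) = h i.
Proof.
apply/existsP/idP => [[j /andP[/eqP/io_inj-> //]]|hi].
by exists i; rewrite eqxx.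
Qed.

Lemma io_neq_out i : io i != out.
Proof.
by have /setD1P[] : io i \in inner_faces G by rewrite io_img imset_f.
Qed.

Lemma up_out h : up h out = false.
Proof. by apply/existsP => -[i /andP[/eqP e _]]; have := io_neq_out i; rewrite e eqxx. Qed.

Lemma face_io d : face d != out -> exists i, face d = io i.
Proof. by rewrite -face_inner io_img => /imsetP[i _ ->]; exists i. Qed.

(* Whether the edge of [d] lies in the matching encoded by [h], when the tail
   of [d] is coloured [true]. *)
Definition chosen h d : bool :=
  ((face d == out) || up h (face d)) &&
  ((face (drev G d) == out) || ~~ up h (face (drev G d))).

Definition in_matching h d : bool :=
  chosen h (if col (dtail d) then d else drev G d).

Definition matching_of h : {set {set G}} :=
  [set edge_of d | d in [pred d | in_matching h d]].

Lemma in_matching_drev h d : in_matching h (drev G d) = in_matching h d.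
Proof. by rewrite /in_matching dtail_drev col_dhead drevK; case: (col _). Qed.

Lemma mem_matching_of h d : (edge_of d \in matching_of h) = in_matching h d.
Proof.
apply/imsetP/idP => [[d' hd' /eqP]|hd]; last by exists d.
by rewrite edge_of_eq !inE => /orP[] /eqP->; rewrite ?in_matching_drev.
Qed.

Lemma matching_of_sub h : matching_of h \subset edges G.
Proof. by apply/subsetP => _ /imsetP[d _ ->]; apply: edge_of_edges. Qed.

Lemma perfect_matchingE (M : {set {set G}}) : M \subset edges G ->
  perfect_matching M = [forall v : G, \sum_(d | dtail d == v) (edge_of d \in M) == 1].
Proof.
move=> sM; rewrite /perfect_matching sM /=; apply: eq_forallb => v.
by rewrite card_matching_at // -sum1dep_card big_mkcondr.
Qed.

Lemma monotone_up h d : monotone dual_rel h -> col (dtail d) ->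
  face d != out -> face (drev G d) != out ->
  up h (face (drev G d)) -> up h (face d).
Proof.
move=> hm cd /face_io[i ei] /face_io[j ej]; rewrite ei ej !up_io; apply: hm.
by apply/existsP; exists d; rewrite cd ei ej !eqxx.
Qed.

(** Take a vertex of colour [true] and degree 3 whose inner faces have, in rotation order, the
    labels a and b. Its edges are chosen under the conditions ~a, a && ~b and b; exactly one holds
    iff b implies a, which is monotonicity across the middle edge. At degree 2 the conditions are ~a
    and a. Colour [false] is symmetric. *)
Lemma matching_of_perfect h : monotone dual_rel h -> perfect_matching (matching_of h).
Proof.
move=> hm; rewrite perfect_matchingE ?matching_of_sub //; apply/forallP => v.
have [o <- fo] := outer_at hG v.
under eq_bigr do rewrite mem_matching_of.
case: (vertex_sum hG (fun d => nat_of_bool (in_matching h d)) fo).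
have fro : face (drev G o) = face (rt o) by rewrite face_of_rot.
have frro : face (drev G (rt o)) = face (rt (rt o)) by rewrite face_of_rot.
move=> ne [[e ->]|[ne2 e ->]].
  rewrite /in_matching !dtail_of_rot /chosen; case: ifP => _; rewrite ?drevK fo fro e.
    by rewrite eqxx (negbTE ne) up_out /=; case: (up _ _).
  by rewrite eqxx (negbTE ne) up_out /=; case: (up _ _).
rewrite /in_matching !dtail_of_rot /chosen; case: ifP => c; rewrite ?drevK fo fro e frro.
  rewrite !eqxx (negbTE ne) (negbTE ne2) up_out /=.
  have := @monotone_up h (rt o) hm; rewrite dtail_of_rot c frro ne ne2.
  by move/(_ isT isT isT); case: (up _ _) (up _ _) => [] [] // /(_ isT).
rewrite !eqxx (negbTE ne) (negbTE ne2) up_out /=.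
have := @monotone_up h (drev G (rt o)) hm.
rewrite dtail_drev col_dhead dtail_of_rot c drevK frro ne ne2.
by move/(_ isT isT isT); case: (up _ _) (up _ _) => [] [] // /(_ isT).
Qed.

Lemma perfect_matching_ofP (M : {set {set G}}) : perfect_matching M ->
  exists2 h, monotone dual_rel h & M = matching_of h.
Proof.
move=> pM; have sM : M \subset edges G by case/andP: pM.
(* The zero labelling encodes the alternating matching of the outer cycle that consists of the outer
   darts with tail coloured [true]. *)
pose h0 : {ffun I -> bool} := [ffun=> false].
have up0 F : up h0 F = false.
  by apply/existsP => -[i]; rewrite ffunE andbF.
have m0 : monotone dual_rel h0 by move=> i j _; rewrite !ffunE.
have pM0 := matching_of_perfect m0.
have sumM := pM; rewrite perfect_matchingE // in sumM; move/forallP: sumM => sumM.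
rewrite perfect_matchingE ?matching_of_sub // in pM0; move/forallP: pM0 => sumM0.
have sum_addb (A : {set {set G}}) v : \sum_(d | dtail d == v) (edge_of d \in A) == 1 ->
    (\sum_(d | dtail d == v) (edge_of d \in A : bool))%R = true.
  move=> /eqP/(congr1 odd) e1; rewrite sum_bool_odd -sum1dep_card big_mkcondr.
  exact: e1.
have [|f fE] := boundary_of_cycle (@pconnected G) (@rotP G) (euler G)
  (x := fun e => (e \in M) (+) (e \in matching_of h0)).
  by move=> v; rewrite big_split /= !sum_addb ?sumM ?sumM0.
(* Adding a constant to [f] changes nothing in [fE]; the labelling is normalised to vanish on the
   outer face. *)
pose h : {ffun I -> bool} := [ffun i => f (io i) (+) f out].
have upE d : up h (face d) = f (face d) (+) f out.
  case: (eqVneq (face d) out) => [->|/face_io[i ->]]; first by rewrite up_out addbb.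
  by rewrite up_io ffunE.
have memM d : col (dtail d) -> (edge_of d \in M) =
    (face d == out) (+) (up h (face d) (+) up h (face (drev G d))).
  move=> c; have := fE d; rewrite -!/(face _) mem_matching_of /in_matching c /chosen.
  rewrite !up0 orbF orbT andbT !upE.
  by case: (_ \in M) (_ == _) (f _) (f _) (f _) => [] [] [] [] [].
(* A violation across the edge of [d] would put both boundary edges at its tail, those of [o] and
   [rt d], into [M]. *)
have hm : monotone dual_rel h.
  move=> i j /existsP[d /and3P[c /eqP fi /eqP fj]].
  rewrite -!(up_io h) -fi -fj => hj; case: (boolP (up h (face d))) => // hi; exfalso.
  have [||o [fo eo e1 e2]] := inner_dart_rot hG (d := d).
  - by rewrite fi io_neq_out.
  - by rewrite fj io_neq_out.
  have fro : face (drev G o) = face d by rewrite eo face_of_rot.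
  have co : col (dtail o) by move: c; rewrite eo dtail_of_rot.
  have oM : edge_of o \in M by rewrite memM // fo eqxx up_out fro (negbTE hi).
  have rM : edge_of (rt d) \in M.
    rewrite memM ?dtail_of_rot // e1 e2 up_out hj.
    by rewrite fj (negbTE (io_neq_out j)).
  have := sumM (dtail o).
  case: (vertex_sum hG (fun x => nat_of_bool (edge_of x \in M)) fo) => _.
  rewrite -eo oM rM => -[[e _]|[_ _ ->]]; last by case: (_ \in M).
  by have := io_neq_out j; rewrite -fj e eqxx.
exists h => //; apply/setP => e; apply/idP/idP => [eM|].
  have /imsetP[d0 _ e0] := subsetP sM _ eM.
  have [d cd ed] : exists2 d, col (dtail d) & e = edge_of d.
    case c : (col (dtail d0)); first by exists d0.
    by exists (drev G d0); rewrite ?edge_of_drev // dtail_drev col_dhead c.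
  rewrite ed in eM *; rewrite mem_matching_of /in_matching cd /chosen.
  move: eM; rewrite memM //.
  case: (eqVneq (face d) out) => [->|ne]; first by rewrite up_out; case: (up _ _); rewrite ?orbT.
  case: (eqVneq (face (drev G d)) out) => [->|ne2]; first by rewrite up_out; case: (up _ _).
  have := monotone_up hm cd ne ne2.
  by case: (up _ _) (up _ _) => [] [].
case/imsetP=> d0 hd0 ->.
have [d cd [ed hd]] : exists2 d, col (dtail d) & edge_of d0 = edge_of d /\ in_matching h d.
  case c : (col (dtail d0)); first by exists d0.
  exists (drev G d0); rewrite ?edge_of_drev ?in_matching_drev //.
  by rewrite dtail_drev col_dhead c.
move: hd; rewrite ed memM // /in_matching cd /chosen.
case: (eqVneq (face d) out) => [e1|ne] /=.
  have := face_neq_drev hG d; rewrite e1 up_out eq_sym => /negbTE->.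
  by case: (up _ _).
case: (eqVneq (face (drev G d)) out) => [->|ne2]; first by rewrite up_out; case: (up _ _).
by case: (up _ _) (up _ _) => [] [].
Qed.

Lemma io_boundary i : exists2 d, face d = io i & face (drev G d) = out.
Proof.
have : io i \in inner_faces G by rewrite io_img imset_f.
by case/inner_face_dart => d -> /boundary_dart; apply.
Qed.

(** A boundary edge depends on the label of its inner face alone, and every inner face has one:
    labels can be read off the matching. *)
Lemma in_matching_boundary h d i : face d = io i -> face (drev G d) = out ->
  in_matching h d = (h i == col (dtail d)).
Proof.
move=> fi fo; rewrite /in_matching /chosen; case: (col _); rewrite ?drevK fi fo eqxx.
  by rewrite (negbTE (io_neq_out i)) up_io andbT; case: (h i).
by rewrite (negbTE (io_neq_out i)) up_io; case: (h i).
Qed.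

Lemma matching_of_inj : injective matching_of.
Proof.
move=> h h' e; apply/ffunP => i; have [d fi fo] := io_boundary i.
have : in_matching h d = in_matching h' d by rewrite -!mem_matching_of e.
by rewrite !(in_matching_boundary _ fi fo); case: (h i) (h' i) (col _) => [] [] [].
Qed.

Lemma mem_symdiff h h' d :
  (edge_of d \in (matching_of h :\: matching_of h') :|: (matching_of h' :\: matching_of h))
  = in_matching h d (+) in_matching h' d.
Proof.
by rewrite !inE !mem_matching_of; case: (in_matching h d) (in_matching h' d) => [] [].
Qed.

(** From left to right, test the equality on a boundary edge of each face. Conversely, if across an
    edge with [dual_rel i j] one label changes, the edge itself changes: were [h j] and [h' j] both
    1, monotonicity would fix the label of [i] to 1, and were [h i] and [h' i] both 0, that of [j]
    to 0. *)
Lemma symdiff_face h h' : monotone dual_rel h -> monotone dual_rel h' ->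
  [exists F in inner_faces G,
     (matching_of h :\: matching_of h') :|: (matching_of h' :\: matching_of h)
     == face_edges F] = (#|[set i | h i != h' i]| == 1).
Proof.
move=> hm hm'; apply/exists_inP/cards1P => [[F]|[i0 i0P]].
  rewrite io_img => /imsetP[i0 _ ->] /eqP sd.
  exists i0; apply/setP => i; rewrite !inE.
  have [d fi fo] := io_boundary i.
  have := mem_symdiff h h' d; rewrite sd !(in_matching_boundary _ fi fo).
  have [d0 f0 _] := io_boundary i0; rewrite -f0 edge_of_face_edges fi fo f0.
  rewrite [out == _]eq_sym (negbTE (io_neq_out i0)) orbF (inj_eq io_inj) => ->.
  by case: (h i) (h' i) (col _) => [] [] [].
have hne i : (h i != h' i) = (i == i0) by move/setP/(_ i): i0P; rewrite !inE.
exists (io i0); first by rewrite io_img imset_f.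
apply/eqP/setP => e.
have [d0 f0 _] := io_boundary i0.
case: (boolP (e \in edges G)) => [|ne]; last first.
  transitivity false.
    apply/negbTE; apply: contra ne; rewrite !inE => /orP[] /andP[_].
      exact/subsetP/matching_of_sub.
    exact/subsetP/matching_of_sub.
  by apply/esym/negbTE; apply: contra ne => /imsetP[d _ ->]; apply: edge_of_edges.
case/imsetP=> d1 _ ->.
have [d cd ->] : exists2 d, col (dtail d) & edge_of d1 = edge_of d.
  case c : (col (dtail d1)); first by exists d1.
  by exists (drev G d1); rewrite ?edge_of_drev // dtail_drev col_dhead c.
rewrite mem_symdiff -f0 edge_of_face_edges f0 /in_matching cd /chosen.
have upne x : face x = out \/ exists2 i, face x = io i & (up h (face x) = h i /\ up h' (face x) = h' i).
  by case: (eqVneq (face x) out) => [|/face_io[i e']]; [left|right; exists i; rewrite ?e' ?up_io].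
case: (upne d) => [e1|[i e1 [u1 u1']]]; case: (upne (drev G d)) => [e2|[j e2 [u2 u2']]].
- by have := face_neq_drev hG d; rewrite e1 e2 eqxx.
- rewrite e1 eqxx /= e2 (inj_eq io_inj) -hne [out == _]eq_sym !(negbTE (io_neq_out _)) /=.
  by rewrite -e2 u2 u2'; case: (h j) (h' j) => [] [].
- rewrite e2 eqxx e1 (inj_eq io_inj) -hne [out == _]eq_sym !(negbTE (io_neq_out _)) /=.
  by rewrite -e1 u1 u1'; case: (h i) (h' i) => [] [].
have ij : i != j.
  by apply: contraNneq (face_neq_drev hG d) => ij; rewrite e1 e2 ij.
have Pij : dual_rel i j by apply/existsP; exists d; rewrite cd e1 e2 !eqxx.
rewrite u1 u1' u2 u2' e1 e2 !(inj_eq io_inj) !(negbTE (io_neq_out _)) /= -!hne.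
have : ~~ ((h i != h' i) && (h j != h' j)).
  by rewrite !hne; apply/negP => /andP[/eqP ei /eqP ej]; rewrite ei ej eqxx in ij.
move/implyP: (hm _ _ Pij); move/implyP: (hm' _ _ Pij).
by case: (h i) (h j) (h' i) (h' j) => [] [] [] [].
Qed.

Lemma resonance_code : exists f : resonance_vertex G -> {ffun I -> bool},
  [/\ injective f, forall M, monotone dual_rel (f M),
      forall h, monotone dual_rel h -> exists M, f M = h
    & forall M N, resonance_adj M N = (#|[set i | f M i != f N i]| == 1)].
Proof.
have [f fm fE] := fin_all_exists2 (fun M : resonance_vertex G => perfect_matching_ofP (valP M)).
exists f; split=> // [M N e|h hm|M N].
- by apply: val_inj; rewrite (fE M) (fE N) e.
- pose M : resonance_vertex G := exist _ (matching_of h) (matching_of_perfect hm).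
  by exists M; apply: matching_of_inj; rewrite -fE.
by rewrite -symdiff_face // -!fE.
Qed.

End Resonance.

(** * Regular triples *)

(** Both resonance graphs are encoded by the same monotone labellings of [I], so the two codes can
    be composed. *)
Lemma resonance_iso_of_dual (G H : plane_graph) (cG : G -> bool) (cH : H -> bool)
    (I : finType) (iG : I -> {set dart G}) (iH : I -> {set dart H}) :
  cers G -> cers H -> proper_colouring cG -> proper_colouring cH ->
  injective iG -> injective iH ->
  inner_faces G = [set iG i | i : I] -> inner_faces H = [set iH i | i : I] ->
  dual_rel cG iG =2 dual_rel cH iH -> resonance_iso G H.
Proof.
move=> hG hH cGP cHP iGi iHi iGE iHE eR.
have [f [f_inj f_mono f_onto f_adj]] := resonance_code hG cGP iGi iGE.
have [k [k_inj k_mono k_onto k_adj]] := resonance_code hH cHP iHi iHE.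
have toH M : exists N, k N = f M.
  by apply: k_onto => i j; rewrite -eR; apply: f_mono.
have toG N : exists M, f M = k N.
  by apply: f_onto => i j; rewrite eR; apply: k_mono.
have [u uE] := fin_all_exists toH; have [v vE] := fin_all_exists toG.
exists u; split.
  by exists v => [M|N]; [apply: f_inj|apply: k_inj]; rewrite ?vE ?uE ?vE.
by move=> M N; rewrite f_adj k_adj !uE.
Qed.

Lemma gdist_geodesic (T : finType) (e : rel T) x y : connect e x y ->
  exists p, [/\ path e x p, last x p = y, size p = gdist e x y
    & forall q, path e x q -> last x q = y -> size p <= size q].
Proof.
case/connectP=> p0 /shortenP[p ep up _] ly.
pose P n := [exists t : n.-tuple T, path e x t && (last x t == y)].
have PP q : path e x q -> last x q = y -> P (size q).
  by move=> eq lq; apply/existsP; exists (in_tuple q); rewrite eq lq eqxx.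
(* A path without repetition has fewer than [#|T|] edges, so the search in [gdist] does not end at
   its default value. *)
have sp : size p < #|T| by have := max_card (mem (x :: p)); rewrite (card_uniqP up).
have hasP : has P (iota 0 #|T|).
  by apply/hasP; exists (size p); rewrite ?mem_iota // PP.
have := nth_find 0 hasP; rewrite nth_iota -?has_find ?size_iota // -?[find _ _]/(gdist e x y).
  rewrite add0n => /existsP[t /andP[et /eqP lt]].
  exists t; rewrite size_tuple; split=> // q eq lq.
  rewrite leqNgt; apply/negP => lt_q.
  have := before_find 0 lt_q; rewrite nth_iota ?add0n; last first.
    by apply: leq_trans lt_q _; rewrite /gdist -[X in _ <= X](size_iota 0) find_size.
  by move=> /negbT/negP[]; exact: PP.
by move: hasP; rewrite has_find size_iota.
Qed.

Section Regularity.
Variable G : plane_graph.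
Hypothesis hG : cers G.
Variable col : G -> bool.
Hypothesis colP : proper_colouring col.
Implicit Types d x y : dart G.
Local Notation rt := (@Defs.rot G).
Local Notation out := (outer G).
Local Notation ladj := (@line_adj G).

Lemma line_adjI e f v : e \in edges G -> f \in edges G -> v \in e -> v \in f ->
  e = f \/ ladj e f.
Proof.
move=> eE fE ve vf; case: (eqVneq e f) => [|ne]; first by left.
by right; rewrite /line_adj /= eE fE ne; apply/set0Pn; exists v; rewrite inE ve.
Qed.

(* Consecutive edges of a line-graph geodesic meet in distinct vertices, which
   form a walk through the intermediate edges. *)
Lemma line_geodesic (e f : {set G}) r : path ladj e (rcons r f) ->
  (forall q, path ladj e q -> last e q = f -> size r < size q) ->
  exists v w : G, [/\ v \in e, v \in head f r, w \in f, w \in last e r &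
    col v (+) col w = odd (size r) /\
    forall g : G -> bool,
      (forall d, edge_of d \in r -> g (dtail d) = g (dhead d)) -> g v = g w].
Proof.
elim: r e => [|e1 r IHr] e /=.
  case/andP=> /and4P[_ _ _ /set0Pn[v]]; rewrite inE => /andP[ve vf] _ _.
  by exists v, v; split=> //; rewrite addbb.
case/andP=> ee1 pr geo.
have [|v2 [w [v21 v2h wf wl [cw gw]]]] := IHr e1 pr.
  by move=> q pq lq; have := geo (e1 :: q); rewrite /= ee1 pq ltnS => /(_ isT lq).
have /and4P[eE e1E _ /set0Pn[v1]] := ee1; rewrite inE => /andP[v1e v11].
(* If the two vertices agreed, [e] would meet the edge [g2] that follows [e1], and skipping [e1]
   would shorten the path. *)
have ne : v1 != v2.
  apply/eqP => e12; rewrite -e12 in v2h.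
  have [g2 [t [g2E gh st pt lt]]] : exists g2 t,
      [/\ g2 \in edges G, head f r = g2, size t = size r, path ladj g2 t & last g2 t = f].
    case: (r) pr => [|g2 r'] /= /andP[/and4P[_ g2E _ _] pr].
      by exists f, [::].
    by exists g2, (rcons r' f); rewrite size_rcons last_rcons.
  rewrite gh in v2h; case: (line_adjI eE g2E v1e v2h) => [eg|eg].
    by have := geo t; rewrite eg pt lt st ltnNge leqnSn => /(_ isT erefl).
  by have := geo (g2 :: t); rewrite /= eg pt lt st ltnn => /(_ isT erefl).
have /imsetP[d0 _ e1d0] := e1E.
have [d ed td] : exists2 d, edge_of d = e1 & dtail d = v1.
  by rewrite e1d0; apply: dart_of_mem_edge; rewrite -e1d0.
have hd : dhead d = v2.
  move: v21; rewrite -ed !inE td => /orP[] /eqP // e21.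
  by rewrite e21 eqxx in ne.
exists v1, w; split=> //; split.
  by rewrite -td -cw -hd (col_dhead colP); case: (col _) (col _) => [] [].
move=> g gr; rewrite -(gw g) => [|d' d'r]; last by apply: gr; rewrite inE d'r orbT.
by rewrite -td -hd; apply: gr; rewrite ed mem_head.
Qed.

(** If the heads were on the same side, the face walk, starting at the head of [x], could never meet
    an edge of the cut, since the tails of [x] and [y] are on the other side; yet it returns to
    [x]. *)
Lemma cut_separates x y (g : G -> bool) : face x = face y ->
  edge_of x != edge_of y ->
  (forall d, g (dtail d) (+) g (dhead d) =
     (edge_of d == edge_of x) (+) (edge_of d == edge_of y)) ->
  g (dhead x) != g (dhead y) /\ g (dtail x) != g (dtail y).
Proof.
move=> fxy ne gE.
have gx : g (dtail x) = ~~ g (dhead x).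
  by have := gE x; rewrite eqxx (negbTE ne); case: (g _) (g _) => [] [].
have gy : g (dtail y) = ~~ g (dhead y).
  by have := gE y; rewrite eqxx eq_sym (negbTE ne); case: (g _) (g _) => [] [].
suff ng : g (dhead x) != g (dhead y) by split; rewrite // gx gy (inj_eq negb_inj).
apply/eqP => gxy.
pose S z := face z = face x /\ g (dtail z) = g (dhead x).
have Sx : S (face_perm G x) by rewrite /S face_of_face_perm dtail_of_face_perm.
have : x \in face (face_perm G x) by rewrite mem_face face_of_face_perm.
case/(porbit_ind (S := S)) => // [z [fz gz]|_]; last by rewrite gx; case: (g _).
rewrite /S face_of_face_perm dtail_of_face_perm; split=> //.
have nz u : face u = face x -> g (dtail u) != g (dhead x) -> edge_of z != edge_of u.
  move=> fu gu; rewrite edge_of_eq !inE; apply/norP; split.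
    by apply: contraNneq gu => <-; rewrite gz.
  by apply: contraNneq (face_neq_drev hG u) => <-; rewrite fu fz.
have := gE z; rewrite gz (negbTE (nz x _ _)) ?gx //; last by case: (g _).
rewrite (negbTE (nz y _ _)) ?gy ?gxy //; last by case: (g _).
by case: (g _) (g _) => [] [].
Qed.

Lemma connect_face_line d d' : face d' = face d ->
  connect ladj (edge_of d) (edge_of d').
Proof.
move=> ef; have : d' \in face d by rewrite mem_face ef.
apply: (porbit_ind (S := fun z => connect ladj (edge_of d) (edge_of z))) => // z cz.
apply: connect_trans cz _.
have := @line_adjI (edge_of z) (edge_of (face_perm G z)) (dhead z).
rewrite !edge_of_edges dhead_edge -{1}dtail_of_face_perm dtail_edge.
by case=> // [->//|]; apply: connect1.
Qed.

(** Suppose the colours differ. A geodesic of even length between the two edges leaves the first at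
    [v] and enters the second at [w], of different colours; so [v] and [w] are both tails or both
    heads. A closed curve through [face d1] and the outer face, crossing the two sides next to [d1]
    and [d2] on the far side from [v] and [w], separates [v] from [w], but the geodesic uses neither
    of these sides. *)
Lemma regular_same_colour d1 d2 : face d1 = face d2 ->
  face d1 != out -> face (drev G d1) != out -> face (drev G d2) != out ->
  face (drev G d1) != face (drev G d2) ->
  regular (face (drev G d1)) (face d1) (face (drev G d2)) ->
  col (dtail d1) = col (dtail d2).
Proof.
move=> f12 fi f1 f2 fne reg; apply/eqP/negPn/negP => ncol.
have fi2 : face d2 != out by rewrite -f12.
have ne12 : edge_of d1 != edge_of d2.
  rewrite edge_of_eq !inE; apply/norP; split.
    by apply: contraNneq fne => ->.
  apply: contraNneq fne => ed; have := face_neq_drev hG d2.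
  by rewrite -f12 ed eqxx.
have := reg (edge_of d1) (edge_of d2); rewrite !inE !edge_of_face_edges f12 !eqxx.
rewrite !orbT => /(_ isT isT); rewrite /edge_dist.
have [p [pp lp <- geo]] := gdist_geodesic (connect_face_line (esym f12)).
case/lastP: p => [|r e] in pp lp geo *; first by rewrite /= in lp; rewrite lp eqxx in ne12.
rewrite last_rcons in lp; rewrite {e}lp in pp geo *.
rewrite size_rcons /= negbK => odd_r.
have [|v [w [v1 vh w2 wl [cvw gvw]]]] := line_geodesic pp.
  by move=> q pq lq; have := geo q pq lq; rewrite size_rcons.
have neq_out a b : face a != out -> face (drev G a) != out ->
    face (drev G b) = out -> edge_of a != edge_of b.
  move=> fa fa' fb; rewrite edge_of_eq !inE; apply/norP; split.
    by apply: contraNneq fa' => ->; rewrite fb.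
  by apply: contraNneq fa => ->; rewrite fb.
(* Here [x] and [y] are the two sides crossed by the curve; they touch [d1] and [d2] but miss [v]
   and [w]. *)
have core x y : face x = face d1 -> face y = face d1 ->
    face (drev G x) = out -> face (drev G y) = out -> x != y ->
    edge_of d1 :&: edge_of x != set0 -> edge_of d2 :&: edge_of y != set0 ->
    v \notin edge_of x -> w \notin edge_of y ->
    (forall g : G -> bool, g (dtail d1) = g (dhead d1) -> g (dtail d2) = g (dhead d2) ->
      g (dhead x) != g (dhead y) -> g (dtail x) != g (dtail y) -> g v != g w) -> False.
  move=> fx fy fx' fy' nxy tx ty vx wy gne.
  have [g gE] : exists g : G -> bool, forall d, g (dtail d) (+) g (dhead d) =
    (edge_of d == edge_of x) (+) (edge_of d == edge_of y).
    by apply: two_edge_cut; rewrite ?fx ?fy ?fx' ?fy'.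
  have gc a : face a != out -> face (drev G a) != out -> g (dtail a) = g (dhead a).
    move=> fa fa'; have := gE a; rewrite !(negbTE (neq_out a _ fa fa' _)) //.
    by case: (g _) (g _) => [] [].
  have exy : edge_of x != edge_of y.
    rewrite edge_of_eq !inE; apply/norP; split=> //.
    by apply: contraNneq (face_neq_drev hG y) => <-; rewrite fx fy.
  have [gh gt] := cut_separates (etrans fx (esym fy)) exy gE.
  have := gne g (gc _ fi f1) (gc _ fi2 f2) gh gt; rewrite (gvw g) ?eqxx // => d dr.
  have := gE d.
  (* The first intermediate edge contains [v], so [x] could only occur later; being adjacent to
     [d1], it would give a shortcut. The case of [y] is the mirror image. *)
  have nx : edge_of d != edge_of x.
    apply: contraNneq vx => ed; rewrite ed in dr.
    case/splitPr: dr pp geo vh => r1 r2 pp geo vh.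
    move: pp; rewrite rcons_cat cat_path /= => /and3P[_ _ p2].
    have := geo (edge_of x :: rcons r2 (edge_of d2)).
    rewrite /= p2 last_rcons /line_adj /= !edge_of_edges neq_out // tx.
    move=> /(_ isT erefl); rewrite !size_rcons size_cat /=.
    by case: r1 vh {geo} => //= a r1 _; rewrite addSn addnS !ltnS ltnNge leq_addl.
  have ny : edge_of d != edge_of y.
    apply: contraNneq wy => ed; rewrite ed in dr.
    case/splitPr: dr pp geo wl => r1 r2 pp geo wl.
    move: pp; rewrite rcons_cat cat_path /= => /and3P[p1 p2 _].
    have := geo (r1 ++ [:: edge_of y; edge_of d2]).
    rewrite cat_path /= p1 p2 last_cat /= /line_adj /= !edge_of_edges.
    rewrite eq_sym neq_out // setIC ty => /(_ isT erefl).
    rewrite size_rcons !size_cat /=.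
    move: wl; rewrite last_cat /=; case: r2 {geo} => //= a r2 _.
    by rewrite !addnS addn0 !ltnS ltnNge leq_addr.
  by rewrite (negbTE nx) (negbTE ny); case: (g _) (g _) => [] [].
have notin (a b : dart G) u u' : edge_of a != edge_of b -> u != u' -> u \in edge_of a ->
    u' \in edge_of a -> u \in edge_of b -> u' \notin edge_of b.
  move=> eab uu' ua u'a ub; apply: contra eab => u'b.
  by rewrite (mem_two_edge uu' ua u'a) (mem_two_edge uu' ub u'b).
have meet (a b : dart G) u : u \in edge_of a -> u \in edge_of b -> edge_of a :&: edge_of b != set0.
  by move=> ua ub; apply/set0Pn; exists u; rewrite inE ua.
have cne : col v != col w by rewrite -negb_add cvw odd_r.
have nd : d1 != d2 by apply: contraNneq ne12 => ->.
have th (a : dart G) : dhead a != dtail a by rewrite eq_sym dtail_neq_dhead.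
case: (eqVneq v (dtail d1)) => [ev|nv].
  have ew : w = dtail d2.
    move: w2; rewrite !inE => /orP[] /eqP // ew.
    by move: cne ncol; rewrite ev ew (col_dhead colP); case: (col _) (col _) => [] [].
  have bd a : face a != out -> face (drev G a) != out ->
      face (drev G (face_perm G a)) = out.
    move=> fa fa'; have [||o [_ _ _]] := inner_dart_rot hG (d := drev G a).
    - by [].
    - by rewrite drevK.
    by rewrite rot_drev.
  have he a : dhead a \in edge_of (face_perm G a).
    by rewrite -dtail_of_face_perm dtail_edge.
  (* Both ends are tails: cross the sides that follow [d1] and [d2] on the face walk. *)
  apply: (core (face_perm G d1) (face_perm G d2));
    rewrite ?face_of_face_perm ?bd // ?(inj_eq perm_inj) //.
  - exact: meet (dhead_edge d1) (he d1).
  - exact: meet (dhead_edge d2) (he d2).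
  - by rewrite ev; apply: (notin d1 (face_perm G d1) (dhead d1) (dtail d1)); rewrite ?dhead_edge ?dtail_edge ?neq_out ?bd.
  - by rewrite ew; apply: (notin d2 (face_perm G d2) (dhead d2) (dtail d2)); rewrite ?dhead_edge ?dtail_edge ?neq_out ?bd.
  by move=> g g1 g2 _; rewrite !dtail_of_face_perm ev ew g1 g2.
have ev : v = dhead d1 by move: v1; rewrite !inE (negbTE nv) => /eqP.
have ew : w = dhead d2.
  move: w2; rewrite !inE => /orP[] /eqP // ew.
  by move: cne ncol; rewrite ev ew (col_dhead colP); case: (col _) (col _) => [] [].
have [o1 [fo1 e1 _ _]] := inner_dart_rot hG fi f1.
have [o2 [fo2 e2 _ _]] := inner_dart_rot hG fi2 f2.
have t1 : dtail o1 = dtail d1 by rewrite e1 dtail_of_rot.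
have t2 : dtail o2 = dtail d2 by rewrite e2 dtail_of_rot.
have m1 : dtail d1 \in edge_of (drev G o1) by rewrite edge_of_drev -t1 dtail_edge.
have m2 : dtail d2 \in edge_of (drev G o2) by rewrite edge_of_drev -t2 dtail_edge.
(* Both ends are heads: cross the sides that precede [d1] and [d2]. *)
apply: (core (drev G o1) (drev G o2)); rewrite ?drevK //.
- by rewrite e1 face_of_rot.
- by rewrite f12 e2 face_of_rot.
- by rewrite (inj_eq perm_inj); apply: contraNneq nd => o12; rewrite e1 e2 o12.
- exact: meet (dtail_edge d1) m1.
- exact: meet (dtail_edge d2) m2.
- by rewrite ev; apply: (notin d1 (drev G o1) (dtail d1) (dhead d1)); rewrite ?dhead_edge ?dtail_edge ?neq_out ?drevK ?dtail_neq_dhead.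
- by rewrite ew; apply: (notin d2 (drev G o2) (dtail d2) (dhead d2)); rewrite ?dhead_edge ?dtail_edge ?neq_out ?drevK ?dtail_neq_dhead.
by move=> g g1 g2; rewrite !dhead_drev t1 t2 g1 g2 ev ew.
Qed.

End Regularity.

(** * The oriented inner dual of a normal cers *)

Definition sym_closure (I : finType) (P : rel I) : rel I := [rel i j | P i j || P j i].

(* The properties of the oriented inner dual of a normal cers that suffice to
   realise it by hexagons. *)
Record hexagonal_dual (I : finType) (P : rel I) : Prop := HexagonalDual {
  hd_inhabited : 0 < #|I|;
  hd_asym : forall i j, P i j -> ~~ P j i;
  hd_connected : forall i j, connect (sym_closure P) i j;
  hd_acyclic : forall c : seq I, 2 < size c ->
    ~~ (path.cycle (sym_closure P) c && uniq c);
  hd_card : #|[set p : I * I | sym_closure P p.1 p.2]| + 2 <= 2 * #|I|;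
  hd_degree : forall i, #|[set j | sym_closure P i j]| <= 3;
  hd_branch : forall i j k, sym_closure P i j -> sym_closure P i k ->
    2 < #|[set j | sym_closure P i j]| -> P i j = P i k
}.

Section NormalDual.
Variable G : plane_graph.
Hypothesis nG : normal_cers G.
Variable col : G -> bool.
Hypothesis colP : proper_colouring col.
Variables (I : finType) (io : I -> {set dart G}).
Hypothesis io_inj : injective io.
Hypothesis io_img : inner_faces G = [set io i | i : I].
Implicit Types d : dart G.
Local Notation out := (outer G).
Local Notation P := (dual_rel col io).
Local Notation A := (sym_closure P).

Let hG : cers G. Proof. by case: nG. Qed.

Let io_inner i : io i \in inner_faces G.
Proof. by rewrite io_img imset_f. Qed.

Lemma dual_adjP i j :
  reflect (exists2 d, face d = io i & face (drev G d) = io j) (A i j).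
Proof.
apply: (iffP orP) => [[] /existsP[d /and3P[_ /eqP fi /eqP fj]]|[d fi fj]].
- by exists d.
- by exists (drev G d); rewrite ?drevK.
case c : (col (dtail d)); [left|right]; apply/existsP.
  by exists d; rewrite c fi fj !eqxx.
exists (drev G d); rewrite drevK fi fj !eqxx.
by rewrite dtail_drev (col_dhead colP) c.
Qed.

Lemma dual_face_adj i j : A i j = face_adj (io i) (io j).
Proof.
apply/dual_adjP/idP => [[d <- <-]|]; first exact/face_adj_drev/face_neq_drev.
have [d di _] := inner_face_dart (io_inner i).
have [d' dj _] := inner_face_dart (io_inner j).
by rewrite di dj => /face_adjP.
Qed.

(** The faces share a single edge, so whichever dart is given decides the direction. *)
Lemma dual_relE i j d : face d = io i -> face (drev G d) = io j -> P i j = col (dtail d).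
Proof.
move=> fi fj; apply/existsP/idP => [[d' /and3P[c /eqP fi' /eqP fj']]|c].
  rewrite (@shared_dart_uniq _ hG d d') ?fi ?fj ?fi' ?fj' //; exact: io_neq_out.
by exists d; rewrite c fi fj !eqxx.
Qed.

Lemma dual_asym i j : P i j -> ~~ P j i.
Proof.
move=> Pij; have /dual_adjP[d fi fj] : A i j by rewrite /sym_closure /= Pij.
rewrite (@dual_relE j i (drev G d)) ?drevK // dtail_drev (col_dhead colP) negbK.
by rewrite -(dual_relE fi fj).
Qed.

(** The edge count of a tree, obtained from Euler's formula: the outer walk visits each vertex once,
    so V edges are on the boundary and E - V = F - 2 = [#|I|] - 1 are shared by inner faces. Each is
    counted in both directions. *)
Lemma card_shared : #|[set p : I * I | A p.1 p.2]| + 2 <= 2 * #|I|.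
Proof.
pose S : {set dart G} := [set d | (face d != out) && (face (drev G d) != out)].
have leS : #|[set p : I * I | A p.1 p.2]| <= #|S|.
  pose ff (p : I * I) := (io p.1, io p.2).
  have ff_inj : injective ff by move=> [i j] [i' j'] [/io_inj-> /io_inj->].
  rewrite -(card_imset _ ff_inj).
  apply: leq_trans (leq_imset_card (fun d => (face d, face (drev G d))) S).
  apply/subset_leq_card/subsetP => q /imsetP[[i j]]; rewrite inE /= => /dual_adjP[d fi fj] ->.
  apply/imsetP; exists d; last by rewrite fi fj.
  by rewrite inE fi fj !io_neq_out.
have cardV : #|outer G| = #|G|.
  rewrite -cardsT -(card_in_imset (f := @dtail G) (D := outer G)).
    apply: eq_card => v; rewrite inE; have [o <- fo] := outer_at hG v.
    by apply/imsetP; exists o; rewrite // mem_outer fo.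
  move=> x y; rewrite !mem_outer => /eqP fx /eqP fy t.
  by apply: (face_inj_at hG t); rewrite fx fy.
have cardS : #|S| + 2 * #|G| = #|dart G|.
  have CS : ~: S = outer G :|: drev G @: outer G.
    apply/setP => d; rewrite !inE mem_outer negb_and !negbK; congr (_ || _).
    apply/eqP/imsetP => [fd|[d' od' ->]].
      by exists (drev G d); rewrite ?drevK // mem_outer fd.
    by rewrite drevK; apply/eqP; rewrite -mem_outer.
  have dis : outer G :&: drev G @: outer G = set0.
    apply/setP => d; rewrite !inE mem_outer; apply/negP => /andP[/eqP fd].
    case/imsetP=> d'; rewrite mem_outer => /eqP fd' dd'.
    by have := face_neq_drev hG d'; rewrite fd' -dd' fd eqxx.
  have := cardsC S; rewrite CS cardsU dis cards0 card_imset; last exact: perm_inj.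
  by rewrite cardV; lia.
have cardI : #|I| + 1 = #|porbits (face_perm G)|.
  by rewrite (cardsD1 out) outerP -/(inner_faces G) io_img card_imset // addnC.
have := euler G; have := card_dart G; lia.
Qed.

Lemma normal_hexagonal_dual : hexagonal_dual P.
Proof.
have [_ deg3 reg] := nG; have [_ [ne0 conn acyc]] := hG.
have AE := dual_face_adj.
have nbE i : io @: [set j | A i j] = [set F in inner_faces G | face_adj (io i) F].
  apply/setP => F; rewrite inE io_img; apply/imsetP/andP.
    by case=> j; rewrite inE AE => Aij ->; rewrite imset_f.
  by case=> /imsetP[j _ ->] Aij; exists j; rewrite // inE AE.
have card_nb i : #|[set j | A i j]| = #|[set F in inner_faces G | face_adj (io i) F]|.
  by rewrite -nbE card_imset.
split.
- case/set0Pn: ne0 => F; rewrite io_img => /imsetP[i _ _].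
  by apply/card_gt0P; exists i.
- exact: dual_asym.
- move=> i j; have := conn _ _ (io_inner i) (io_inner j).
  move/(connect_ind (S := fun F => forall k, F = io k -> connect A i k)).
  apply=> // [F F' /= /and3P[iF iF' aFF'] IH k ek|k /io_inj-> //].
  move: iF; rewrite io_img => /imsetP[l _ el].
  apply: connect_trans (IH _ el) (connect1 _).
  by rewrite AE -el -ek.
- move=> c sc; have := acyc (map io c) _ _; rewrite size_map => /(_ _ sc).
  rewrite map_inj_uniq // => H; apply: contra (H _) => [/andP[cc ->]|F /mapP[i _ -> //]].
  rewrite andbT; case: c cc {sc H} => //= x p; rewrite -map_rcons path_map.
  by rewrite (eq_path (e' := A)) // => i j; rewrite /= AE.
- exact: card_shared.
- by move=> i; rewrite card_nb deg3.
move=> i j k Aij Aik gt2.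
case: (eqVneq j k) => [-> //|jk].
(* Normality speaks of faces with three distinct neighbours; [l] is the third one. *)
have [l /andP[Ail /andP[lj lk]]] : exists l, A i l && ((l != j) && (l != k)).
  apply/existsP; apply: contraLR gt2 => /existsPn nex; rewrite -leqNgt.
  apply: leq_trans (_ : #|[set j; k]| <= 2); last by rewrite cards2; case: (_ != _).
  apply/subset_leq_card/subsetP => l; rewrite !inE => Ail.
  by have := nex l; rewrite Ail /= -negb_or negbK.
have ion a b : a != b -> io a != io b by rewrite (inj_eq io_inj).
have := reg (io i) (io j) (io k) (io l); rewrite -!AE !io_inner !ion // 1?eq_sym //.
case=> // rg _ _.
have /dual_adjP[d1 fi1 fj] := Aij; have /dual_adjP[d2 fi2 fk] := Aik.
rewrite (dual_relE fi1 fj) (dual_relE fi2 fk).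
apply: (regular_same_colour hG colP); rewrite ?fi1 ?fi2 ?fj ?fk ?io_neq_out //.
exact: ion.
Qed.

End NormalDual.

(** * Gluing hexagons along an oriented tree *)

Section HexagonPositions.
Variables (I : finType) (P : rel I).
Hypothesis hd : hexagonal_dual P.
Local Notation A := (sym_closure P).

Lemma sym_closureC i j : A i j = A j i.
Proof. by rewrite /sym_closure /= orbC. Qed.

Lemma sym_closure_irr i : A i i = false.
Proof.
apply/negP => /orP Pii; have {}Pii : P i i by case: Pii.
by have := hd_asym hd Pii; rewrite Pii.
Qed.

Lemma sym_closure_flip i j : A i j -> P j i = ~~ P i j.
Proof.
have := @hd_asym _ _ hd i j; have := @hd_asym _ _ hd j i.
by rewrite /sym_closure /=; case: (P i j) (P j i) => [] [] // _ /(_ isT).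
Qed.

(** The hexagons with dual edges in both directions; by [hd_branch] these have exactly two
    neighbours. *)
Let mixed i := [exists j, exists k, [&& A i j, A i k & P i j != P i k]].

(* The side of the hexagon [i] glued to the hexagon [j]; its parity records the
   direction of the dual edge, and neighbouring sides are never both used. *)
Definition side_nat i j : nat :=
  if mixed i then (if P i j then 0 else 3)
  else (index j (enum [set k | A i k])).*2 + ~~ P i j.

Lemma side_nat_lt i j : A i j -> side_nat i j < 6.
Proof.
move=> Aij; rewrite /side_nat; case: ifP => _; first by case: (P i j).
have : index j (enum [set k | A i k]) < 3.
  by apply: leq_trans (hd_degree hd i); rewrite cardE index_mem mem_enum inE.
by case: (P i j) => /=; lia.
Qed.

Lemma odd_side_nat i j : odd (side_nat i j) = ~~ P i j.
Proof.
rewrite /side_nat; case: ifP => _; first by case: (P i j).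
by rewrite oddD odd_double; case: (P i j).
Qed.

(** In the mixed case the two neighbours get the opposite sides 0 and 3. Otherwise all sides in use
    have the same parity, and cyclically consecutive sides differ in parity since 6 is even. *)
Lemma side_nat_apart i j k : A i j -> A i k -> j != k ->
  side_nat i k != side_nat i j /\ side_nat i k != (side_nat i j).+1 %% 6.
Proof.
move=> Aij Aik jk; have lj := side_nat_lt Aij; have lk := side_nat_lt Aik.
case: (boolP (mixed i)) => mi.
  suff ne : P i j != P i k.
    rewrite /side_nat mi; move: ne; case: (P i j) (P i k) => [] [] //.
  apply/eqP => ePjk; have /existsP[j' /existsP[k' /and3P[Aj' Ak' /eqP[]]]] := mi.
  case: (leqP #|[set l | A i l]| 2) => [le2|]; last exact: hd_branch.
  have nbE : [set l | A i l] = [set j; k].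
    apply/esym/eqP; rewrite eqEcard cards2 jk le2 andbT.
    by apply/subsetP => l; rewrite !inE => /orP[] /eqP->.
  have nb l : A i l -> P i l = P i j.
    move=> Ail; have : l \in [set j; k] by rewrite -nbE inE.
    by rewrite !inE => /orP[] /eqP->.
  by rewrite !nb.
have eP : P i j = P i k.
  apply/eqP; apply: contraNT mi => ne; apply/existsP; exists j; apply/existsP; exists k.
  by rewrite Aij Aik.
have ne : index j (enum [set l | A i l]) != index k (enum [set l | A i l]).
  apply: contra jk => /eqP e.
  have mem l : A i l -> l \in enum [set l | A i l] by rewrite mem_enum inE.
  by rewrite -(nth_index j (mem j Aij)) e nth_index // mem.
move: lj lk; rewrite /side_nat (negbTE mi) eP; move: ne.
by case: (P i k) => /=; lia.
Qed.

End HexagonPositions.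

(** * Sides, corners and their gluing *)

Section HexagonalSystem.
Variables (I : finType) (P : rel I).
Hypothesis hd : hexagonal_dual P.
Local Notation A := (sym_closure P).

(* [(i, k)] stands for the [k]-th side of the hexagon [i], oriented along the
   face walk, as well as for the initial corner of that side. *)
Let C : finType := (I * 'I_6)%type.
Implicit Types c : C.

Let nx c : C := (c.1, ordS c.2).
Let pv c : C := (c.1, ord_pred c.2).
Let side i j : 'I_6 := inord (side_nat P i j).

(** The side glued to [c]; an unglued side is its own mate, which makes [mate] an involution. *)
Let mate c : C :=
  if [pick j | A c.1 j && (side c.1 j == c.2)] is Some j then (j, side j c.1) else c.
Let gl c : bool := [exists j, A c.1 j && (side c.1 j == c.2)].

Let nxK : cancel nx pv.
Proof. by case=> i k; rewrite /pv /nx /= ordSK. Qed.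

Let pvK : cancel pv nx.
Proof. by case=> i k; rewrite /pv /nx /= ord_predK. Qed.

Let nx_inj : injective nx := can_inj nxK.

Let odd_nx c : odd (nx c).2 = ~~ odd c.2.
Proof. by case: c => i [k lk] /=; do 6?case: k lk => [|k] lk //. Qed.

Let nx2 c : nx (nx c) != c.
Proof.
by case: c => i [k lk]; rewrite -pair_eqE /= eqxx -val_eqE /=; do 6?case: k lk => [|k] lk //.
Qed.

Let sideE i j : A i j -> side i j = side_nat P i j :> nat.
Proof. by move=> Aij; rewrite /side inordK // side_nat_lt. Qed.

Let side_inj i j k : A i j -> A i k -> side i j = side i k -> j = k.
Proof.
move=> Aij Aik e; apply/eqP/negPn/negP => jk.
have [/eqP[]] := side_nat_apart hd Aij Aik jk.
by rewrite -!sideE // e.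
Qed.

Let glP c : reflect (exists2 j, A c.1 j & c = (c.1, side c.1 j)) (gl c).
Proof.
apply: (iffP existsP) => [[j /andP[Aj /eqP e]]|[j Aj e]]; exists j => //.
  by rewrite e -surjective_pairing.
by rewrite Aj {2}e eqxx.
Qed.

Let gl_side i j : A i j -> gl (i, side i j).
Proof. by move=> Aij; apply/glP; exists j. Qed.

Let mate_side i j : A i j -> mate (i, side i j) = (j, side j i).
Proof.
move=> Aij; rewrite /mate /=; case: pickP => [k /andP[Aik /eqP e]|/(_ j)].
  by rewrite (side_inj Aik Aij e).
by rewrite Aij eqxx.
Qed.

Let mate_id c : ~~ gl c -> mate c = c.
Proof.
move=> ngl; rewrite /mate; case: pickP => // j jP; case/negP: ngl.
by apply/existsP; exists j.
Qed.

Let mateK : involutive mate.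
Proof.
move=> c; case: (boolP (gl c)) => [/glP[j Aj ->]|ngl]; last by rewrite !mate_id.
by rewrite !mate_side // sym_closureC.
Qed.

Let mate_inj : injective mate := inv_inj mateK.

Let gl_mate c : gl (mate c) = gl c.
Proof.
case: (boolP (gl c)) => [/glP[j Aj ->]|ngl]; last by rewrite mate_id // (negbTE ngl).
by rewrite mate_side // gl_side // sym_closureC.
Qed.

(** This keeps the identification of corners simple: a corner is shared through at most one of its
    two sides, hence by at most two hexagons. *)
Let gl_nx c : gl c -> ~~ gl (nx c).
Proof.
move=> /glP[j Aj ->]; set i := c.1 in Aj *; apply/negP => /glP[k /= Ak [e]].
have [jk|jk] := eqVneq j k.
  have := congr1 (fun l : 'I_6 => odd l) e; rewrite -jk.
  have -> : odd (ordS (side i j)) = ~~ odd (side i j) by exact: (odd_nx (i, side i j)).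
  by case: (odd _).
have [_ /eqP[]] := side_nat_apart hd Aj Ak jk.
by rewrite -!sideE // -e.
Qed.

Let mate_face c : gl c -> A c.1 (mate c).1.
Proof. by case/glP=> j Aj ->; rewrite mate_side. Qed.

Let mate_neq c : gl c -> (mate c).1 != c.1.
Proof.
by move=> /mate_face; apply: contraTneq => ->; rewrite (sym_closure_irr hd).
Qed.

(** Gluing reverses a side, so opposite parities of glued sides are what makes the parity of a
    corner well defined on vertices. *)
Let odd_mate c : gl c -> odd (mate c).2 = ~~ odd c.2.
Proof.
case/glP=> j Aj ->; rewrite mate_side //= !sideE ?odd_side_nat //.
  by rewrite (sym_closure_flip hd Aj).
by rewrite sym_closureC.
Qed.

Let mate_uniq c c' : gl c -> gl c' -> c.1 = c'.1 -> (mate c).1 = (mate c').1 -> c = c'.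
Proof.
by case/glP=> j Aj -> /glP[k Ak ->] /= e; rewrite !mate_side //= => ->; rewrite e.
Qed.

Let mate_ex i j : A i j -> exists c, [/\ gl c, c.1 = i & (mate c).1 = j].
Proof. by move=> Aij; exists (i, side i j); rewrite gl_side ?mate_side. Qed.

Let dir_mate c : gl c -> P c.1 (mate c).1 = ~~ odd c.2.
Proof. by case/glP=> j Aj ->; rewrite mate_side //= sideE // odd_side_nat negbK. Qed.

(* Every vertex is the initial corner of exactly one unglued side. *)
Let V : finType := {c : C | ~~ gl c}.
Implicit Types u v w : V.

(** The initial corner of a glued side is identified with the final corner of its mate, which starts
    an unglued side. *)
Let vt c : C := if gl c then nx (mate c) else c.

Let vtP c : ~~ gl (vt c).
Proof. by rewrite /vt; case: ifPn => // g; rewrite gl_nx // gl_mate. Qed.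

Let vx c : V := exist _ (vt c) (vtP c).

Let vxK u : vx (val u) = u.
Proof. by apply: val_inj; rewrite /= /vt (negbTE (valP u)). Qed.

Let val_vx c : ~~ gl c -> val (vx c) = c.
Proof. by move=> g; rewrite /= /vt (negbTE g). Qed.

Let vx_mate c : gl c -> vx (nx (mate c)) = vx c.
Proof. by move=> g; apply: val_inj; rewrite /= /vt g (negbTE (gl_nx _)) // gl_mate. Qed.

Let vx_mate_nx c : gl c -> vx (mate c) = vx (nx c).
Proof. by move=> g; rewrite -[in RHS](mateK c) vx_mate // gl_mate. Qed.

Let vx_eq c c' : vx c = vx c' ->
  [\/ c = c', gl c /\ c' = nx (mate c) | gl c' /\ c = nx (mate c')].
Proof.
move/(congr1 val); rewrite /= /vt; case: ifP => g; case: ifP => g' e.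
- by apply: Or31; apply/mate_inj/nx_inj.
- by apply: Or32.
- by apply: Or33.
- by apply: Or31.
Qed.

Definition corner_colour c : bool := ~~ odd c.2.

Let colour_vx c : corner_colour (val (vx c)) = corner_colour c.
Proof.
rewrite /= /vt /corner_colour; case: ifP => // g.
by rewrite odd_nx odd_mate // negbK.
Qed.

Let hadj : rel V := [rel v w | [exists c,
  ((vx c == v) && (vx (nx c) == w)) || ((vx c == w) && (vx (nx c) == v))]].

Let hadj_colour v w : hadj v w -> corner_colour (val v) != corner_colour (val w).
Proof.
case/existsP=> c /orP[] /andP[/eqP<- /eqP<-]; rewrite !colour_vx /corner_colour odd_nx.
  by case: (odd _).
by case: (odd _).
Qed.

Let hadj_sym : symmetric hadj.
Proof. by move=> v w; apply: eq_existsb => c; rewrite orbC. Qed.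

Let hadj_irr : irreflexive hadj.
Proof. by move=> v; case h : (hadj v v) => //; have := hadj_colour h; rewrite eqxx. Qed.

Definition hexagon_graph : sgraph := SGraph hadj_sym hadj_irr.
Local Notation H := hexagon_graph.

(* The outer side of an unglued side is represented by [inr]. *)
Let D : finType := (C + V)%type.
Let tl (x : D) : V := match x with inl c => vx c | inr u => vx (nx (val u)) end.
Let hl (x : D) : V := match x with inl c => vx (nx c) | inr u => u end.

Let hadj_dart x : hadj (tl x) (hl x).
Proof.
apply/existsP; case: x => [c|u] /=; first by exists c; rewrite !eqxx.
by exists (val u); rewrite vxK !eqxx orbT.
Qed.

Let dl (x : D) : dart H := exist (fun p : V * V => hadj p.1 p.2) (tl x, hl x) (hadj_dart x).

(** Part of the simplicity of the graph: an inner and an outer dart with the same ends would give a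
    hexagon glued to itself, two hexagons glued along two sides, a glued side among the unglued
    ones, or a corner with [nx (nx c) = c]. *)
Let inl_inr c u : vx c = vx (nx (val u)) -> vx (nx c) = u -> False.
Proof.
have ngu := valP u.
move=> /vx_eq E1; rewrite -(vxK u) => /vx_eq; move: (val u) ngu E1 => {}u ngu E1.
case=> [e2|[g2 e2]|[g _]]; last by rewrite g in ngu.
  case: E1 => [e1|[g1 /nx_inj e1]|[g1 e1]].
  - by have /eqP[] := nx2 u; rewrite -e1.
  - by rewrite e1 gl_mate g1 in ngu.
  have f1 : c.1 = (mate (nx u)).1 by rewrite {1}e1.
  have f2 : c.1 = (nx u).1 by rewrite -e2.
  by have := mate_neq g1; rewrite -f1 f2 eqxx.
case: E1 => [e1|[g1 /nx_inj e1]|[g1 e1]].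
- have f1 : (nx c).1 = u.1 by rewrite e1.
  have f2 : u.1 = (mate (nx c)).1 by rewrite {1}e2.
  by have := mate_neq g2; rewrite f1 f2 eqxx.
- by rewrite e1 gl_mate g1 in ngu.
have e : mate (nx c) = nx u.
  apply: mate_uniq; rewrite ?gl_mate //; first by rewrite e2.
  by rewrite mateK e1.
by have /eqP[] := nx2 u; rewrite -{1}e -e2.
Qed.

Let dl_inj : injective dl.
Proof.
move=> x y /(congr1 val) /= [].
case: x y => [c|u] [c'|u'] /=.
- move=> E1 E2; congr inl; case: (vx_eq E1) => [//|[g e]|[g e]].
    case: (vx_eq E2) => [/nx_inj //|[g2 _]|[g2 /nx_inj e2]].
      by have := gl_nx g; rewrite g2.
    by have /eqP[] := nx2 (mate c); rewrite -e e2 mateK.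
  case: (vx_eq E2) => [/nx_inj //|[g2 /nx_inj e2]|[g2 _]].
    by have /eqP[] := nx2 (mate c'); rewrite -e e2 mateK.
  by have := gl_nx g; rewrite g2.
- by move=> E1 E2; case: (inl_inr E1 E2).
- by move=> E1 E2; case: (inl_inr (esym E1) (esym E2)).
by move=> _ ->.
Qed.

Let rvD (x : D) : D := match x with
  | inl c => if gl c then inl (mate c) else inr (vx c)
  | inr u => inl (val u) end.

Let tl_rvD x : tl (rvD x) = hl x.
Proof.
case: x => [c|u] /=; last exact: vxK.
by case: ifPn => g /=; rewrite ?vx_mate_nx // /vt (negbTE g).
Qed.

Let hl_rvD x : hl (rvD x) = tl x.
Proof.
by case: x => [c|u] //=; case: ifPn => g //=; rewrite vx_mate.
Qed.

Let drev_dl x : drev H (dl x) = dl (rvD x).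
Proof.
by apply: dart_inj; rewrite ?dtail_drev ?dhead_drev; apply/esym; [exact: tl_rvD|exact: hl_rvD].
Qed.

Let rvDK : involutive rvD.
Proof. by move=> x; apply: dl_inj; rewrite -!drev_dl drevK. Qed.

Let dl_surj d : exists x, dl x == d.
Proof.
suff [x tx hx] : exists2 x, tl x = dtail d & hl x = dhead d.
  by exists x; apply/eqP/dart_inj.
have /existsP[c /orP[] /andP[/eqP e1 /eqP e2]] := adj_dart d.
  by exists (inl c).
by exists (rvD (inl c)); rewrite ?tl_rvD ?hl_rvD.
Qed.

Let dli d : D := xchoose (dl_surj d).

Let dliK : cancel dli dl.
Proof. by move=> d; apply/eqP; exact: (xchooseP (dl_surj d)). Qed.

Let dlK : cancel dl dli.
Proof. by move=> x; apply: dl_inj; rewrite dliK. Qed.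

(** * The outer walk and the rotation *)

(** Outer darts run backwards along unglued sides. After the side [c] comes the preceding side or,
    if that one is glued, the side preceding its mate in the neighbouring hexagon. *)
Let omc c : C := if gl (pv c) then pv (mate (pv c)) else pv c.

Let gl_pv c : gl c -> ~~ gl (pv c).
Proof. by apply: contraTN => /gl_nx; rewrite pvK. Qed.

Let gl_omc c : ~~ gl (omc c).
Proof. by rewrite /omc; case: ifPn => // g; rewrite gl_pv // gl_mate. Qed.

Let om u : V := vx (omc (val u)).

Let val_om u : val (om u) = omc (val u).
Proof. exact/val_vx/gl_omc. Qed.

Let pv_inj : injective pv := can_inj pvK.

Let om_inj : injective om.
Proof.
move=> u w /(congr1 val); rewrite !val_om /omc => e; apply: val_inj; move: e.
have [ngu ngw] := (valP u, valP w).
case: ifP => gu; case: ifP => gw /pv_inj //.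
- by move/mate_inj/pv_inj.
- by move=> e; rewrite -e gl_mate gu in ngw.
- by move=> e; rewrite e gl_mate gw in ngu.
Qed.

Let phi (x : D) : D := match x with inl c => inl (nx c) | inr u => inr (om u) end.

Let phi_inj : injective phi.
Proof.
case=> [c|u] [c'|u'] //.
  by move/(congr1 (fun x : D => if x is inl a then a else c)) => /nx_inj ->.
by move/(congr1 (fun x : D => if x is inr a then a else u)) => /om_inj ->.
Qed.

Let tl_phi x : tl (phi x) = hl x.
Proof.
case: x => [//|u]; rewrite -[tl _]/(vx (nx (val (om u)))) val_om -[hl _]/u /omc.
case: ifPn => g; rewrite pvK ?vxK //.
by rewrite vx_mate_nx // pvK vxK.
Qed.

(** The face permutation [phi] is chosen first; since it has to be the reversal followed by the
    rotation, the rotation must be [phi] after the reversal. *)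
Let rotf d : dart H := dl (phi (rvD (dli d))).

Let rotf_inj : injective rotf.
Proof.
by move=> d d' /dl_inj/phi_inj/(inv_inj rvDK) e; rewrite -(dliK d) e dliK.
Qed.

Definition hexagon_rot : {perm dart H} := perm rotf_inj.
Local Notation hrot := hexagon_rot.

Let hrotE x : hrot (dl x) = dl (phi (rvD x)).
Proof. by rewrite permE /rotf dlK. Qed.

Let dtail_dl x : dtail (dl x) = tl x. Proof. by []. Qed.
Let dhead_dl x : dhead (dl x) = hl x. Proof. by []. Qed.

(** At most two turns lead from any dart to the inner dart of the unglued side that starts at its
    tail. *)
Let same_orbit x : dl x \in porbit hrot (dl (inl (val (tl x)))).
Proof.
have fwd y y' : phi (rvD y) = y' -> dl y \in porbit hrot (dl y').
  by move=> <-; rewrite -hrotE porbit_sym; have := mem_porbit hrot 1 (dl y); rewrite expg1.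
have inlP c : dl (inl c) \in porbit hrot (dl (inl (val (vx c)))).
  case: (boolP (gl c)) => g; last by rewrite val_vx // porbit_id.
  by apply: fwd; rewrite /= g /= /vt g.
case: x => [c|u] /=; first exact: inlP.
have /eqP <- : porbit hrot (dl (inl (nx (val u)))) == porbit hrot (dl (inl (val (vx (nx (val u)))))).
  by rewrite eq_porbit_mem inlP.
exact: fwd.
Qed.

Lemma hexagon_rotP d : porbit hrot d = [set d' | dtail d' == dtail d].
Proof.
apply/setP => d'; rewrite inE; apply/idP/eqP => [|t].
  apply: (porbit_ind (S := fun z => dtail z = dtail d)) => // z <-.
  by rewrite -(dliK z) hrotE !dtail_dl tl_phi hl_rvD.
have := same_orbit (dli d'); have := same_orbit (dli d).
rewrite -!dtail_dl !dliK t -!eq_porbit_mem => /eqP-> /eqP->.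
exact: eqxx.
Qed.

Local Notation fp := (drev H * hrot)%g.

Let fpE x : fp (dl x) = dl (phi x).
Proof. by rewrite permM drev_dl hrotE rvDK. Qed.

Lemma hexagon_connected : connected H.
Proof.
pose e := [rel u v | [&& u \in [set: V], v \in [set: V] & hadj u v]].
have e_sym : connect_sym e.
  by apply: sym_connect_sym => u v; rewrite /= !inE hadj_sym.
have step c : connect e (vx c) (vx (nx c)).
  by apply: connect1; rewrite /= !inE; apply: (hadj_dart (inl c)).
have same i k k' : connect e (vx (i, k)) (vx (i, k')).
  suff to0 l : connect e (vx (i, ord0)) (vx (i, l)).
    by apply: connect_trans (to0 k'); rewrite e_sym.
  case: l => l; elim: l => [|l IHl] ltl; first by rewrite (_ : Ordinal ltl = ord0) //; apply: val_inj.
  apply: connect_trans (IHl (ltnW ltl)) _.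
  have := step (i, Ordinal (ltnW ltl)); rewrite /nx /= (_ : ordS _ = Ordinal ltl) //.
  by apply: val_inj; rewrite /= modn_small.
have corner i j k k' : connect e (vx (i, k)) (vx (j, k')).
  have := hd_connected hd i j.
  move/(connect_ind (S := fun l => forall k', connect e (vx (i, k)) (vx (l, k')))).
  apply=> // a b /mate_ex[c [g ca cb]] IH k''.
  apply: connect_trans (IH c.2) _; rewrite -ca -surjective_pairing -vx_mate //.
  by rewrite -cb; case: (mate c) => ? ? /=; apply: same.
move=> u v _ _; rewrite -(vxK u) -(vxK v).
by case: (val u) (val v) => [i k] [j k']; apply: corner.
Qed.


Let hexface i : {set dart H} := [set dl (inl (i, k)) | k : 'I_6].

Let porbit_inl c : porbit fp (dl (inl c)) = hexface c.1.
Proof.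
have to0 i l : porbit fp (dl (inl (i, l))) = porbit fp (dl (inl (i, ord0))).
  case: l => l; elim: l => [|l IHl] ltl.
    by rewrite (_ : Ordinal ltl = ord0) //; apply: val_inj.
  rewrite -(IHl (ltnW ltl)) -[in RHS](porbit_perm fp 1) expg1 fpE.
  congr (porbit _ (dl (inl (_, _)))).
  by apply: val_inj; rewrite /= modn_small.
case: c => i k /=; apply/setP => d; apply/idP/imsetP => [|[l _ ->]]; last first.
  by rewrite -eq_porbit_mem !to0.
apply: (porbit_ind (S := fun z => exists2 l, l \in 'I_6 & z = dl (inl (i, l)))).
  by move=> z [l _ ->]; exists (ordS l); rewrite ?fpE.
by exists k.
Qed.

Let mem_hexface x i : (dl x \in hexface i) = (if x is inl c then c.1 == i else false).
Proof.
apply/imsetP/idP => [[k _ /dl_inj ->]|]; first exact: eqxx.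
by case: x => // -[j k] /= /eqP->; exists k.
Qed.

Let hexface_inj : injective hexface.
Proof.
move=> i j e; have : dl (inl (i, ord0)) \in hexface i by rewrite mem_hexface eqxx.
by rewrite e mem_hexface => /eqP.
Qed.

Let card_hexface i : #|hexface i| = 6.
Proof.
by rewrite card_imset ?card_ord // => k k' /dl_inj [].
Qed.

(** * Euler's formula for the hexagon system *)

Let card_glued : #|[set c | gl c]| + 2 <= 2 * #|I|.
Proof.
apply: leq_trans (hd_card hd); rewrite leq_add2r.
rewrite -(card_in_imset (f := fun c => (c.1, (mate c).1)) (D := [set c | gl c])).
  apply/subset_leq_card/subsetP => q /imsetP[c]; rewrite inE => g ->.
  by rewrite inE mate_face.
by move=> c c'; rewrite !inE => g g' [e e']; apply: mate_uniq.
Qed.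

Let card_V : #|V| + #|[set c | gl c]| = 6 * #|I|.
Proof.
have -> : #|V| = #|~: [set c | gl c]|.
  by rewrite card_sig; apply: eq_card => c; rewrite !inE.
by rewrite addnC cardsC card_prod card_ord mulnC.
Qed.

Let card_darts : #|dart H| = 6 * #|I| + #|V|.
Proof.
by rewrite -(bij_eq_card (Bijective dlK dliK)) card_sum card_prod card_ord mulnC.
Qed.

Section OuterFace.
Variable u0 : V.
Let O : {set dart H} := porbit fp (dl (inr u0)).

Let O_hexface i : O != hexface i.
Proof.
by apply/eqP => e; have := porbit_id fp (dl (inr u0)); rewrite -/O e mem_hexface.
Qed.

Let hex_faces_sub : O |: [set hexface i | i : I] \subset porbits fp.
Proof.
apply/subsetP => F; rewrite !inE => /orP[/eqP->|/imsetP[i _ ->]]; first exact: imset_f.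
by rewrite -(porbit_inl (i, ord0)); apply: imset_f.
Qed.

Let card_hex_faces : #|O |: [set hexface i | i : I]| = #|I| + 1.
Proof.
rewrite cardsU1 card_imset // (_ : O \notin _) ?addn1 //.
by apply/negP => /imsetP[i _ /eqP]; rewrite (negbTE (O_hexface i)).
Qed.

(* Euler's inequality leaves room for a single outer face. *)
Let hex_porbits : porbits fp = O |: [set hexface i | i : I].
Proof.
apply/esym/eqP; rewrite eqEcard hex_faces_sub card_hex_faces /=.
(* E - V is half the number [g] of glued sides, hence at most [#|I|] - 1. *)
have arith (v f e d g n : nat) : g + 2 <= 2 * n -> v + g = 6 * n -> d = 6 * n + v ->
    d = e.*2 -> v + f <= e + 2 -> f <= n + 1 by lia.
exact: (arith _ _ _ _ _ _ card_glued card_V card_darts (card_dart H)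
  (euler_ineq hexagon_connected hexagon_rotP)).
Qed.

(** With [#|I|] + 1 faces, Euler's inequality bounds E - V from below by [#|I|] - 1, and the bound
    on glued sides gives the same value from above. *)
Lemma hexagon_euler : #|H| + #|porbits fp| = #|edges H| + 2.
Proof.
have arith (v f e d g n : nat) : g + 2 <= 2 * n -> v + g = 6 * n -> d = 6 * n + v ->
    d = e.*2 -> v + f <= e + 2 -> f = n + 1 -> v + f = e + 2 by lia.
apply: (arith _ _ _ _ _ _ card_glued card_V card_darts (card_dart H)
  (euler_ineq hexagon_connected hexagon_rotP)).
by rewrite hex_porbits card_hex_faces.
Qed.

Lemma hexagon_outerP : O \in porbits fp.
Proof. exact: imset_f. Qed.

Definition hexagon_plane : plane_graph :=
  PlaneGraph hexagon_connected hexagon_rotP hexagon_euler hexagon_outerP.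
Local Notation K := hexagon_plane.

Let face_inl c : face (dl (inl c) : dart K) = hexface c.1.
Proof. exact: porbit_inl. Qed.

Let face_inr u : face (dl (inr u) : dart K) = O.
Proof.
have : face (dl (inr u) : dart K) \in porbits fp by apply: imset_f.
rewrite hex_porbits !inE => /orP[/eqP //|/imsetP[i _ e]].
have {}e : porbit fp (dl (inr u)) = hexface i := e.
by have := porbit_id fp (dl (inr u)); rewrite e mem_hexface.
Qed.

Let inner_hex : inner_faces K = [set hexface i | i : I].
Proof.
rewrite /inner_faces -[porbits _]/(porbits fp) hex_porbits setU1K //.
by apply/negP => /imsetP[i _ /eqP]; rewrite (negbTE (O_hexface i)).
Qed.

(** * The hexagon system is a catacondensed benzenoid graph *)

(** The outer darts form one face and correspond to the vertices, so [om] runs through a Hamiltonian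
    cycle. *)
Let om_ind (T : V -> Prop) u w : (forall x, T x -> T (om x)) -> T u -> T w.
Proof.
move=> Tom Tu; have : dl (inr w) \in porbit fp (dl (inr u)).
  by rewrite -eq_porbit_mem; apply/eqP; rewrite [LHS](face_inr w) -(face_inr u).
move=> wu; suff [w' /dl_inj [->] //] : exists2 w', dl (inr w) = dl (inr w') & T w'.
apply: (porbit_ind (S := fun z => exists2 w', z = dl (inr w') & T w')) wu.
  by move=> z [w' -> Tw']; exists (om w'); rewrite ?fpE //; apply: Tom.
by exists u.
Qed.

Let hadj_om u : hadj u (om u).
Proof. by have := hadj_dart (inr (om u)); rewrite -[inr (om u)]/(phi (inr u)) tl_phi. Qed.

(** Deleting [v] from the Hamiltonian cycle leaves a path that starts at [om v]. *)
Let hex_two_connected : two_connected H.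
Proof.
split; last 2 first.
- exact: hexagon_connected.
- move=> v; pose e := [rel x y | [&& x \in [set~ v], y \in [set~ v] & hadj x y]].
  have e_sym : connect_sym e.
    by apply: sym_connect_sym => x y; rewrite /= hadj_sym andbCA.
  have reach x : x != v -> connect e (om v) x.
    have [->|//] : x = v \/ connect e (om v) x; last by rewrite eqxx.
    apply: (@om_ind (fun y => y = v \/ connect e (om v) y) v x); last by left.
    move=> y Ty; case: (eqVneq (om y) v) => [|nv]; first by left.
    right; case: (eqVneq y v) => [-> //|yv].
    case: Ty => [yv'|cy]; first by rewrite yv' eqxx in yv.
    by apply: connect_trans cy (connect1 _); rewrite /= !inE yv nv hadj_om.
  move=> x y; rewrite !inE => xv yv.
  by apply: connect_trans (reach y yv); rewrite e_sym; apply: reach.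
have arith (v g n : nat) : 0 < n -> v + g = 6 * n -> g + 2 <= 2 * n -> 2 < v by lia.
exact: (arith _ _ _ (hd_inhabited hd) card_V card_glued).
Qed.

Let hex_boundary (v : K) : boundary_vertex v.
Proof.
apply/existsP; exists (dl (inr (om v))).
rewrite mem_outer [face _]face_inr eqxx /=; apply/eqP.
exact: (tl_phi (inr v)).
Qed.

Let hex_degree (v : H) : degree v = 2 \/ degree v = 3.
Proof.
(* The ends of the unglued side starting at [v], of the outer dart leaving [v], and of the mate of
   the preceding side. If that side is unglued, the third vertex is [v] itself, so [N3] is only an
   upper bound for the neighbours. *)
pose N3 := [set vx (nx (val v)); om v; vx (nx (mate (pv (val v))))].
have sub3 : [set w | adj v w] \subset N3.
  apply/subsetP => w; rewrite inE => /dart_of_adj[d]; rewrite -(dliK d) dtail_dl dhead_dl.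
  case: (dli d) => [c|u] tv <-; rewrite !inE.
    rewrite -(vxK v) in tv; case: (vx_eq tv) => [->|[g e]|[g _]].
    - by rewrite eqxx.
    - by rewrite e nxK mateK eqxx !orbT.
    by have := valP v; rewrite g.
  have [om' _ omK] := injF_bij om_inj.
  have := tl_phi (inr (om' u)) : tl (inr (om (om' u))) = om' u.
  by rewrite omK tv => ->; rewrite omK eqxx orbT.
have ne : vx (nx (val v)) != om v.
  apply/eqP => e; suff /dl_inj : dl (inl (val v)) = dl (inr (om v)) by [].
  apply: dart_inj; rewrite ?dtail_dl ?dhead_dl //.
  by rewrite -[inr (om v)]/(phi (inr v)) tl_phi; apply: vxK.
have sub2 : [set vx (nx (val v)); om v] \subset [set w | adj v w].
  apply/subsetP => w; rewrite !inE => /orP[] /eqP->; last exact: hadj_om.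
  by have := hadj_dart (inl (val v)); rewrite /= vxK.
have := subset_leq_card sub3; have := subset_leq_card sub2.
rewrite -/(degree v) cards2 ne => ge2 le; have {le}: degree v <= 3.
  apply: leq_trans le _; rewrite cardsU cards2 cards1.
  by apply: leq_trans (leq_subr _ _) _; case: (_ != _).
by move: ge2; case: (degree v) => [|[|[|[|n]]]] //; [left|right].
Qed.

Let hexface_adj i j : face_adj (hexface i : {set dart K}) (hexface j) = A i j.
Proof.
pose c0 l : C := (l, ord0).
apply/idP/idP => [|/mate_ex[c [g ci cj]]].
  rewrite -(face_inl (c0 i)) -(face_inl (c0 j)) => /face_adjP[d].
  rewrite -(dliK d) drev_dl !face_inl; case: (dli d) => [c|u] /=; last first.
    by rewrite [face _]face_inr => /eqP; rewrite (negbTE (O_hexface _)).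
  rewrite [face _]face_inl => /hexface_inj <-; case: ifPn => g.
    by rewrite [face _]face_inl => /hexface_inj <-; apply: mate_face.
  by rewrite [face _]face_inr => /eqP; rewrite (negbTE (O_hexface _)).
have := @face_adj_drev K (dl (inl c)); rewrite drev_dl /= g !face_inl ci cj; apply.
by rewrite (inj_eq hexface_inj) -ci -cj eq_sym mate_neq.
Qed.

Let hex_tree : tree_on (@face_adj K) (inner_faces K).
Proof.
rewrite inner_hex; split.
- have /card_gt0P[i _] := hd_inhabited hd.
  by apply/set0Pn; exists (hexface i); rewrite imset_f.
- move=> x y /imsetP[i _ ->] /imsetP[j _ ->].
  have := hd_connected hd i j.
  set e := (X in connect X _ _); set e' := (X in _ -> connect X _ _).
  move/(connect_ind (S := fun l => connect e' (hexface i) (hexface l))); apply=> // a b Aab cia.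
  apply: connect_trans cia (connect1 _).
  by apply/and3P; split; [exact: imset_f|exact: imset_f|rewrite hexface_adj].
move=> c sub_c gt2.
have [s cE] : exists s, c = map hexface s.
  elim: c sub_c {gt2} => [|F c IHc] sub_c; first by exists [::].
  have /imsetP[i _ Fi] := sub_c F (mem_head _ _).
  have [|s ->] := IHc; first by move=> z zc; apply: sub_c; rewrite inE zc orbT.
  by exists (i :: s); rewrite Fi.
rewrite cE size_map in gt2; apply: contra (hd_acyclic hd gt2).
rewrite cE map_inj_uniq // => /andP[cyc ->]; rewrite andbT.
case: s cyc {cE gt2} => //= x p; rewrite -map_rcons path_map.
by rewrite (eq_path (e' := A)) // => i j; apply: hexface_adj.
Qed.

Let hcol (v : K) : bool := corner_colour (val v).

Let hex_dual_rel : dual_rel hcol (hexface : I -> {set dart K}) =2 P.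
Proof.
move=> i j; apply/existsP/idP => [[d /and3P[]]|Pij].
  rewrite -(dliK d) drev_dl; case: (dli d) => [c|u] /= cc; last first.
    by rewrite [face _]face_inr (negbTE (O_hexface _)).
  rewrite [face _]face_inl (inj_eq hexface_inj) => /eqP <-; case: ifPn => g.
    rewrite [face _]face_inl (inj_eq hexface_inj) => /eqP <-.
    by rewrite dir_mate //; move: cc; rewrite /hcol [val _]/(val (vx c)) colour_vx.
  by rewrite [face _]face_inr (negbTE (O_hexface _)).
have /mate_ex[c [g ci cj]] : A i j by rewrite /sym_closure /= Pij.
exists (dl (inl c)); rewrite drev_dl /= g [face _]face_inl [X in _ && (X == _)]face_inl.
rewrite ci cj !eqxx !andbT /hcol [val _]/(val (vx c)) colour_vx /corner_colour.
by rewrite -dir_mate // ci cj.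
Qed.

Lemma hexagon_plane_spec : catacondensed_benzenoid K /\
  exists (col : K -> bool) (io : I -> {set dart K}),
    [/\ proper_colouring col, injective io, inner_faces K = [set io i | i : I]
      & dual_rel col io =2 P].
Proof.
split; last by exists hcol, hexface; split=> // x y; apply: hadj_colour.
split; last by move=> F; rewrite inner_hex => /imsetP[i _ ->]; apply: card_hexface.
split; last exact: hex_tree.
split.
- by exists hcol => x y; apply: hadj_colour.
- exact: hex_two_connected.
- by move=> v; rewrite hex_boundary.
- by move=> v _; apply: hex_degree.
Qed.

End OuterFace.

Lemma exists_benzenoid_dual : exists H : plane_graph, catacondensed_benzenoid H /\
  exists (col : H -> bool) (io : I -> {set dart H}),
    [/\ proper_colouring col, injective io, inner_faces H = [set io i | i : I]
      & dual_rel col io =2 P].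
Proof.
have /card_gt0P[i _] := hd_inhabited hd.
(* Any vertex selects the same outer face, since all outer darts lie on one walk. *)
exists (hexagon_plane (vx (i, ord0))); exact: hexagon_plane_spec.
Qed.

End HexagonalSystem.

Theorem theorem5p3 (G : plane_graph) (hG : normal_cers G) :
  exists H : plane_graph, catacondensed_benzenoid H /\ resonance_iso G H.
Proof.
have [cG _ _] := hG; have [[[col colP] _ _ _] _] := cG.
pose I : finType := {F : {set dart G} | F \in inner_faces G}.
have io_img : inner_faces G = [set val i | i : I].
  apply/setP => F; apply/idP/imsetP => [FP|[i _ ->]]; last exact: valP.
  by exists (exist _ F FP).
have hd := normal_hexagonal_dual hG colP val_inj io_img.
have [H [bH [colH [io [colHP io_inj ioE eP]]]]] := exists_benzenoid_dual hd.
exists H; split=> //; have [cH _] := bH.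
apply: (resonance_iso_of_dual cG cH colP colHP val_inj io_inj io_img ioE) => i j.
by rewrite eP.
Qed.
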